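(* Let $F:\mathbb{R}^n\to\mathbb{R}^n$ be a single-valued continuously differentiable map and suppose the system $\dot x=F(x)$ is backward complete. Let $X_o,X_u\subset\mathbb{R}^n$ with $X_o$ closed and $X_o\cap X_u=\emptyset$. Then the system is safe with respect to $(X_o,X_u)$ if and only if there exists a continuous time-varying barrier function candidate $B:\mathbb{R}_{\geq0}\times\mathbb{R}^n\to\mathbb{R}$ for safety with respect to $(X_o,X_u)$ which is of class $\mathcal{C}^1$ on $(\mathbb{R}_{\geq0}\times\mathbb{R}^n)\setminus K$, where $K:=\{(t,x)\in\mathbb{R}_{\geq0}\times\mathbb{R}^n: B(t,x)\le0\}$, and such that $$\Big\langle \nabla B(t,x),\begin{bmatrix}1\\ F(x)\end{bmatrix}\Big\rangle\le 0\qquad \forall (t,x)\in(\mathbb{R}_{\geq0}\times\mathbb{R}^n)\setminus K.$$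
   Context: Solutions of $\dot x=F(x)$ are absolutely continuous functions on intervals $[0,T]$ or $[0,T)$, $T\in[0,\infty]$, satisfying the equation almost everywhere. A solution is maximal if it cannot be extended; the system is forward complete if every maximal solution has unbounded domain, and backward complete if $\dot x=-F(x)$ is forward complete. The system is safe with respect to $(X_o,X_u)$ if every solution starting in $X_o$ never takes values in $X_u$. A time-varying barrier function candidate for safety with respect to $(X_o,X_u)$ is a function $B:\mathbb{R}_{\geq0}\times\mathbb{R}^n\to\mathbb{R}$ with $B(t,x)>0$ for all $(t,x)\in\mathbb{R}_{\geq0}\times X_u$ and $B(t,x)\le0$ for all $(t,x)\in\mathbb{R}_{\geq0}\times X_o$. $\nabla B(t,x)\in\mathbb{R}^{n+1}$ denotes the gradient with respect to $(t,x)$. *)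

(* Defs.v *)
From HB Require Import structures.
From mathcomp Require Import all_boot all_order all_algebra.
From mathcomp Require Import all_classical all_reals all_analysis.
Set Implicit Arguments. Unset Strict Implicit. Unset Printing Implicit Defensive.
Import Order.TTheory GRing.Theory Num.Theory.
Import numFieldNormedType.Exports.
Local Open Scope classical_set_scope.
Local Open Scope ring_scope.

Section Defs.
Variables (R : realType) (n : nat).

Definition basis_vec (i : 'I_n) : 'rV[R]_n := delta_mx 0 i.

Definition abs_cont_on (a b : R) (f : R -> 'rV[R]_n) : Prop :=
  forall e : R, 0 < e -> exists2 d : R, 0 < d &
    forall (m : nat) (l r : 'I_m -> R),
      (forall k, a <= l k /\ l k <= r k /\ r k <= b) ->
      (forall k k', k != k' -> r k <= l k' \/ r k' <= l k) ->
      \sum_(k < m) (r k - l k) < d ->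
      \sum_(k < m) `|f (r k) - f (l k)| < e.

Definition sol_domain (D : set R) : Prop :=
  (exists T : R, 0 <= T /\ D = `[0, T]%classic) \/
  (exists T : \bar R, (0 <= T)%E /\ D = [set t : R | 0 <= t /\ (t%:E < T)%E]).

Definition is_solution (F : 'rV[R]_n -> 'rV[R]_n) (D : set R) (x : R -> 'rV[R]_n)
  : Prop :=
  sol_domain D /\
  (forall b, D b -> abs_cont_on 0 b x) /\
  {ae (@lebesgue_measure R), forall t, D t -> is_derive t (1:R) x (F (x t))}.

Definition maximal_solution (F : 'rV[R]_n -> 'rV[R]_n) (D : set R)
  (x : R -> 'rV[R]_n) : Prop :=
  is_solution F D x /\
  ~ (exists (D' : set R) (y : R -> 'rV[R]_n),
        is_solution F D' y /\ D `<=` D' /\ D != D' /\ (forall t, D t -> y t = x t)).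

Definition forward_complete (F : 'rV[R]_n -> 'rV[R]_n) : Prop :=
  forall D x, maximal_solution F D x -> ~ has_ubound D.

Definition backward_complete (F : 'rV[R]_n -> 'rV[R]_n) : Prop :=
  forward_complete (fun z => - F z).

Definition safe (F : 'rV[R]_n -> 'rV[R]_n) (Xo Xu : set 'rV[R]_n) : Prop :=
  forall D x, is_solution F D x -> D 0 -> Xo (x 0) -> forall t, D t -> ~ Xu (x t).

Definition C1_map (F : 'rV[R]_n -> 'rV[R]_n) : Prop :=
  forall i : 'I_n,
    (forall z, derivable F z (basis_vec i)) /\ continuous ('D_(basis_vec i) F).

Definition tdir : R * 'rV[R]_n := (1, 0).
Definition xdir (i : 'I_n) : R * 'rV[R]_n := (0, basis_vec i).

Definition C1_on_open (U : set (R * 'rV[R]_n)) (f : R * 'rV[R]_n -> R) : Prop :=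
  open U /\
  forall v, (v = tdir \/ exists i, v = xdir i) ->
    forall p, U p -> derivable f p v /\ {for p, continuous ('D_v f)}.

Definition C1_on (S : set (R * 'rV[R]_n)) (f : R * 'rV[R]_n -> R) : Prop :=
  exists U, S `<=` U /\ C1_on_open U f.

Definition lie_der (B : R * 'rV[R]_n -> R) (F : 'rV[R]_n -> 'rV[R]_n)
  (p : R * 'rV[R]_n) : R :=
  'D_tdir B p + \sum_(i < n) 'D_(xdir i) B p * F p.2 0 i.

Definition barrier_candidate (Xo Xu : set 'rV[R]_n) (B : R * 'rV[R]_n -> R) : Prop :=
  (forall t x, 0 <= t -> Xu x -> 0 < B (t, x)) /\
  (forall t x, 0 <= t -> Xo x -> B (t, x) <= 0).

End Defs.

(* Main.v *)
Require Import Defs.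
From HB Require Import structures.
From mathcomp Require Import all_boot all_order all_algebra.
From mathcomp Require Import all_classical all_reals all_analysis.
From mathcomp Require Import measurable_realfun.
From mathcomp Require Import ring lra.
Import Order.TTheory GRing.Theory Num.Theory.
Import numFieldNormedType.Exports.
Local Open Scope classical_set_scope.
Local Open Scope ring_scope.

(** An absolutely continuous solution is continuously differentiable, so a
    barrier, being nonincreasing along it wherever positive, cannot become
    positive on a solution issued from [Xo]: barriers give safety.

    Conversely, let [x1] be in [Xu] and [t1 >= 0]. Backward completeness yields
    the backward trajectory [gam] with [gam t1 = x1], and safety says that it
    avoids [Xo] on [[0, t1]]. With [a] large with respect to a Lipschitz constant
    of [F] near [gam], the function [exp (a t) |x - gam t|^2] is nondecreasing
    along the flow, so a decreasing bump function of it is a C^1 function that is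
    positive at [(t1, x1)], nonincreasing along the flow, and supported in a thin
    tube that does not meet [Xo]. The differentiability of the flow with respect
    to initial conditions is never needed. Countably many such tubes cover
    [[0, oo) x Xu], and a rapidly convergent sum of them is the barrier. *)

(** * Mean value inequality for absolutely continuous functions *)

(** Time dependence is what makes the converse work. The full backward orbit of a point of [Xu] may
    accumulate on [Xo] or escape to infinity, so that no tube of fixed width and no single Lipschitz
    constant fits it. For a point (t1, x1) only the arc over [0, t1] matters: it is compact, hence
    at positive distance from the closed set [Xo], and the tube may be cut off before time 0. As [F]
    may fail to be forward complete, [gam] cannot in general follow the flow past t1. It continues
    along its tangent line, with a defect at most linear in t - t1, the same order as the derivative
    of [sqpos (t - t1)].

    Each tube function is nonnegative and satisfies the Lie derivative inequality at every t >= 0,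
    not only where it is positive. The inequality is therefore additive and survives summation, and
    [K] is the zero set of the sum. *)

Lemma is_derive_epsP (R : realFieldType) (V W : normedModType R) (f : V -> W)
    (a v : V) (df : W) :
  is_derive a v f df <->
  forall e : R, 0 < e -> exists2 d : R, 0 < d &
    forall h : R, `|h| < d -> `|f (h *: v + a) - f a - h *: df| <= e * `|h|.
Proof.
pose g (h : R) := h^-1 *: ((f \o shift a) (h *: v) - f a).
have quotE (h : R) (w : W) : h != 0 ->
    `|w - g h| = `|h|^-1 * `|f (h *: v + a) - f a - h *: w|.
  move=> h0; rewrite distrC -normfV -normrZ.
  by rewrite [in RHS]scalerBr scalerA mulVf // scale1r.
split=> [[dfa <-] e e0|H].
  have /cvgrPdist_le/(_ e e0) : g @ 0^' --> 'D_v f a by exact: dfa.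
  move=> /nbhs_ballP[d /= d0 Hd]; exists d => // h hd.
  have [->|h0] := eqVneq h 0.
    by rewrite !scale0r add0r !subrr !normr0 mulr0.
  have := Hd h; rewrite /ball /= sub0r normrN => /(_ hd h0).
  by rewrite quotE // mulrC ler_pdivrMr ?normr_gt0.
have gdf : g @ 0^' --> df.
  apply/cvgrPdist_le => e e0; have [d d0 Hd] := H e e0.
  apply/nbhs_ballP; exists d => //= h.
  rewrite /ball /= sub0r normrN => hd h0.
  by rewrite quotE // mulrC ler_pdivrMr ?normr_gt0 // Hd.
by split; [apply/cvg_ex; exists df | exact/cvg_lim].
Qed.

(* Cousin's lemma: compactness of [a, b] in the form of an induction. *)
Lemma interval_induction (R : realType) (a b : R) (P : R -> Prop) :
  a <= b -> P a ->
  (forall s, a <= s <= b -> exists2 d : R, 0 < d & forall c c',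
     a <= c <= s -> s <= c' <= b -> s - d < c -> c' < s + d -> P c -> P c') ->
  P b.
Proof.
move=> ab Pa step.
pose S := [set c | a <= c <= b /\ P c].
have Sa : S a by split; rewrite ?lexx.
have ubS : ubound S b by move=> c [/andP[]].
have supS : has_sup S by split; [exists a|exists b].
have as_ : a <= sup S by apply: sup_upper_bound.
have sb : sup S <= b by apply: ge_sup => //; exists a.
have [d d0 Hd] := step (sup S) (introT andP (conj as_ sb)).
have [c [/andP[ac cb] Pc] cs] := sup_adherent d0 supS.
have cS : c <= sup S by apply: sup_upper_bound => //; split => //; apply/andP.
have step1 c' : sup S <= c' <= b -> c' < sup S + d -> P c'.
  by move=> h1 h2; apply: (Hd c c') => //; apply/andP.
have [bd|bd] := ltP b (sup S + d); first by apply: step1; rewrite ?sb ?lexx.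
have Sd : S (sup S + d / 2).
  have h : sup S + d / 2 <= b by lra.
  split; first by rewrite h andbT; lra.
  by apply: step1; rewrite ?h ?andbT; lra.
have := sup_upper_bound supS Sd; lra.
Qed.

(** Lists replace families over ['I_m] because the subdivision in [abs_cont_mean_value] grows by
    prepending one interval at a time. *)
Lemma abs_cont_on_seq {R : realType} {n : nat} {a b : R} {f : R -> 'rV[R]_n} :
  abs_cont_on a b f -> forall e : R, 0 < e -> exists2 d : R, 0 < d &
  forall s : seq (R * R),
    (forall q, q \in s -> a <= q.1 /\ q.1 <= q.2 /\ q.2 <= b) ->
    pairwise (fun q q' => (q.2 <= q'.1) || (q'.2 <= q.1)) s ->
    \sum_(q <- s) (q.2 - q.1) < d ->
    \sum_(q <- s) `|f q.2 - f q.1| < e.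
Proof.
move=> acf e e0; have [d d0 Hd] := acf e e0; exists d => // s sab sdisj.
rewrite !(big_tnth _ _ s); apply: (Hd _ (fun k => (tnth (in_tuple s) k).1)
   (fun k => (tnth (in_tuple s) k).2)) => [k|k k' kk'].
  exact/sab/mem_tnth.
have /pairwiseP H := sdisj.
rewrite !(tnth_nth (a, a)) /=.
have [lt|gt|/val_inj eq] := ltngtP k k'; last by rewrite eq eqxx in kk'.
  by apply/orP/(H (a, a)); rewrite ?inE.
by apply/orP; rewrite orbC; apply/(H (a, a)); rewrite ?inE.
Qed.

Lemma negligible_open_cover {R : realType} {A : set R} {d : R} :
  measurable A -> (@lebesgue_measure R A = 0)%E -> 0 < d ->
  exists U, [/\ open U, A `<=` U & (@lebesgue_measure R U < d%:E)%E].
Proof.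
move=> mA A0 d0.
have Aoo : (@lebesgue_measure R A < +oo)%E by rewrite A0 ltry.
have [U [oU AU UAd]] := lebesgue_regularity_outer mA Aoo d0.
exists U; split => //.
rewrite -(setDUK AU) measureU //.
- by rewrite [X in (X + _)%E](A0 : _ = 0%E) add0e.
- by apply: measurableD => //; exact: open_measurable.
- by rewrite setDE setICA setICr setI0.
Qed.

(* Subdivide [a, b] finely: an interval tagged at a point where [f] is
   differentiable is controlled by the derivative, the others lie in a small
   open neighbourhood of the exceptional set and are controlled by absolute
   continuity. *)
Lemma abs_cont_mean_value {R : realType} {n : nat} {a b M : R}
    {f : R -> 'rV[R]_n} {w : 'rV[R]_n} :
  a <= b -> 0 <= M -> abs_cont_on a b f ->
  {ae (@lebesgue_measure R), forall t, a <= t <= b ->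
     exists2 df, is_derive t (1 : R) f df & `|df - w| <= M} ->
  `|f b - f a - (b - a) *: w| <= M * (b - a).
Proof.
move=> ab M0 acf [A [mA A0 NA]].
apply/ler_addgt0Pr => eta eta0.
(* The three shares of [eta]: [e * (b - a)] for the intervals tagged at good points, [e] for the
   variation of [f] over the bad ones, [|w| * e] for the total length of the bad ones. *)
pose e := eta / ((b - a) + 1 + `|w|).
have k0 : 0 < (b - a) + 1 + `|w|.
  by have := normr_ge0 w; lra.
have e0 : 0 < e by rewrite divr_gt0.
have etaE : eta = e * (b - a) + e + `|w| * e.
  by rewrite /e -[LHS](divfK (lt0r_neq0 k0)); ring.
have [d' d'0 Hd'] := abs_cont_on_seq acf e e0.
pose d := Num.min d' e.
have d0 : 0 < d by rewrite lt_min d'0.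
pose mu := @lebesgue_measure R.
have [U [oU AU UAd]] := negligible_open_cover mA A0 d0.
have mU : measurable U by exact: open_measurable.
(* The list [s] records only the bad intervals. Comparing their total length with the measure of [U]
   on []a, c]] keeps it below [d], so that absolute continuity can be applied to them at the end. *)
pose P c := exists s : seq (R * R),
  [/\ forall q, q \in s -> a <= q.1 /\ q.1 <= q.2 /\ q.2 <= c,
      pairwise (fun q q' => (q.2 <= q'.1) || (q'.2 <= q.1)) s,
      ((\sum_(q <- s) (q.2 - q.1))%:E <= mu (U `&` `]a, c]))%E &
      `|f c - f a - (c - a) *: w| <= (M + e) * (c - a) +
         \sum_(q <- s) (`|f q.2 - f q.1| + `|w| * (q.2 - q.1))].
suff [s [sab sdisj smu sbd]] : P b.
  have sd : \sum_(q <- s) (q.2 - q.1) < d.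
    rewrite -lte_fin; apply: le_lt_trans smu _; apply: le_lt_trans UAd.
    by apply: le_measure; rewrite ?inE //; exact: measurableI.
  have sd' : \sum_(q <- s) (q.2 - q.1) < d' by apply: lt_le_trans sd _; rewrite ge_min lexx.
  have se : \sum_(q <- s) (q.2 - q.1) < e by apply: lt_le_trans sd _; rewrite ge_min lexx orbT.
  apply: le_trans sbd _; rewrite big_split /= -mulr_sumr.
  have H1 := Hd' s sab sdisj sd'.
  have H2 : `|w| * \sum_(q <- s) (q.2 - q.1) <= `|w| * e.
    by rewrite ler_wpM2l // ltW.
  rewrite etaE; lra.
apply: (@interval_induction R a b P ab) => [|t tab].
  exists [::]; split => //.
  - by rewrite big_nil measure_ge0.
  - by rewrite big_nil !subrr scale0r subr0 mulr0 addr0 normr0.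
(* Near a tag in [U] the whole piece []c, c']] lies in [U]; it joins the list. *)
have [Ut|nUt] := pselect (U t).
  have /nbhs_ballP[r /= r0 Hr] : nbhs t U by exact: open_nbhs_nbhs.
  exists r => // c c' /andP[ac ct] /andP[tc' c'b] rc rc' [s [sab sdisj smu sbd]].
  have cc' := le_trans ct tc'.
  have cc'U : `]c, c'] `<=` U.
    move=> y /=; rewrite in_itv /= => /andP[cy yc']; apply: Hr.
    by rewrite /ball /= distrC ltr_distl; apply/andP; split; lra.
  exists ((c, c') :: s); split.
  - move=> q; rewrite inE => /orP[/eqP -> //|/sab[h1 [h2 h3]]].
    by do !split => //; exact: le_trans h3 cc'.
  - rewrite /= sdisj andbT; apply/allP => q /sab[_ [_ h]] /=.
    by rewrite h orbT.
  - rewrite big_cons /= [c' - c + _]addrC EFinD.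
    have mI : measurable (U `&` `]a, c]) by exact: measurableI.
    have -> : (c' - c)%:E = mu `]c, c']%classic.
      rewrite /mu lebesgue_measure_itv /= lte_fin.
      by case: ltgtP cc' => // -> _; rewrite subrr.
    apply: (@le_trans _ _ (mu (U `&` `]a, c]) + mu `]c, c']%classic)%E).
      exact: leeD2r.
    rewrite -measureU //.
      apply: le_measure; rewrite ?inE.
      + exact: measurableU.
      + exact: measurableI.
      + move=> y [[Uy]|cy]; last first.
          split; first exact: cc'U.
          by move: cy; rewrite /= !in_itv /= => /andP[? ->]; rewrite andbT; lra.
        by rewrite /= !in_itv /= => /andP[? ?]; split => //; apply/andP; split; lra.
    apply/seteqP; split => // y [[_]]; rewrite /= !in_itv /= => /andP[? ?] /andP[? ?].
    lra.
  rewrite big_cons /=.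
  have -> : f c' - f a - (c' - a) *: w =
      (f c - f a - (c - a) *: w) + ((f c' - f c) - (c' - c) *: w).
    have -> : c' - a = (c - a) + (c' - c) by ring.
    by apply/rowP => i; rewrite !mxE; ring.
  apply: le_trans (ler_normD _ _) _.
  have H : `|f c' - f c - (c' - c) *: w| <= `|f c' - f c| + `|w| * (c' - c).
    apply: le_trans (ler_normB _ _) _; rewrite normrZ ger0_norm ?subr_ge0 //.
    by rewrite mulrC.
  have ? : 0 <= (M + e) * (c' - c).
    by rewrite mulr_ge0 ?subr_ge0 // addr_ge0 // ltW.
  lra.
(* A tag outside [U] is outside [A]: there [f] has a derivative within [M] of [w], and the list
   stays as it is. *)
have [df dft dfw] : exists2 df, is_derive t (1 : R) f df & `|df - w| <= M.
  by apply: contrapT => nH; apply/nUt/AU/NA => /(_ tab).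
have [r r0 Hr] := (is_derive_epsP _ _ _ _ _ _ _).1 dft e e0.
have incr h : `|h| < r -> `|f (t + h) - f t - h *: w| <= (M + e) * `|h|.
  move=> /Hr; rewrite scaler1 [h + t]addrC => H.
  have -> : f (t + h) - f t - h *: w =
      (f (t + h) - f t - h *: df) + h *: (df - w).
    by rewrite scalerBr addrA subrK.
  apply: le_trans (ler_normD _ _) _; rewrite normrZ.
  have : `|h| * `|df - w| <= `|h| * M by rewrite ler_wpM2l.
  lra.
exists r => // c c' /andP[ac ct] /andP[tc' c'b] rc rc' [s [sab sdisj smu sbd]].
have cc' := le_trans ct tc'.
exists s; split => //.
- by move=> q /sab[h1 [h2 h3]]; do !split => //; exact: le_trans h3 cc'.
- apply: le_trans smu _; apply: le_measure; rewrite ?inE; try exact: measurableI.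
  move=> y [Uy]; rewrite /= !in_itv /= => /andP[? ?]; split => //.
  by apply/andP; split; lra.
have H1 : `|f c' - f t - (c' - t) *: w| <= (M + e) * (c' - t).
  have := incr (c' - t); rewrite ger0_norm ?subr_ge0 // [t + _]addrC subrK.
  by apply; lra.
have H2 : `|f c - f t - (c - t) *: w| <= (M + e) * (t - c).
  have := incr (c - t); rewrite distrC ger0_norm ?subr_ge0 // [t + _]addrC subrK.
  by apply; lra.
(* Since [c <= t <= c'], the errors on the two sides of the tag add up to [(M + e) * (c' - c)]. *)
have -> : f c' - f a - (c' - a) *: w = (f c - f a - (c - a) *: w) +
    ((f c' - f t - (c' - t) *: w) - (f c - f t - (c - t) *: w)).
  have -> : c' - a = (c - a) + ((c' - t) - (c - t)) by ring.
  apply/rowP => i; rewrite !mxE; ring.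
apply: le_trans (ler_normD _ _) _.
have := ler_normB (f c' - f t - (c' - t) *: w) (f c - f t - (c - t) *: w).
lra.
Qed.

(** * Absolutely continuous solutions *)

Lemma abs_cont_onW {R : realType} {n : nat} {a b a' b' : R}
    {f : R -> 'rV[R]_n} :
  a <= a' -> b' <= b -> abs_cont_on a b f -> abs_cont_on a' b' f.
Proof.
move=> aa' bb' acf e /acf[d d0 Hd]; exists d => // m l r lr; apply: Hd => k.
by have [? [? ?]] := lr k; do !split; lra.
Qed.

Lemma eq_abs_cont_on {R : realType} {n : nat} {a b : R}
    {f g : R -> 'rV[R]_n} :
  (forall t, a <= t <= b -> f t = g t) ->
  abs_cont_on a b f -> abs_cont_on a b g.
Proof.
move=> fg acf e /acf[d d0 Hd]; exists d => // m l r lr dis sm.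
rewrite (eq_bigr (fun k => `|f (r k) - f (l k)|)); first exact: Hd.
by move=> k _; have [? [? ?]] := lr k; rewrite !fg //; apply/andP; split; lra.
Qed.

Lemma abs_cont_on_reflect {R : realType} {n : nat} {b : R}
    {f : R -> 'rV[R]_n} {c : R} :
  0 <= c <= b -> abs_cont_on 0 b f -> abs_cont_on 0 c (fun t => f (b - t)).
Proof.
move=> /andP[c0 cb] acf e /acf[d d0 Hd]; exists d => // m l r lr dis sm.
rewrite (eq_bigr (fun k => `|f (b - l k) - f (b - r k)|)); last first.
  by move=> k _; rewrite distrC.
apply: (Hd m (fun k => b - r k) (fun k => b - l k)).
- by move=> k; have [? [? ?]] := lr k; do !split; lra.
- by move=> k k' /dis[?|?]; [right|left]; lra.
- by rewrite (eq_bigr (fun k => r k - l k)) // => k _; ring.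
Qed.

Lemma abs_cont_on_dist {R : realType} {n : nat} {a b : R}
    {f : R -> 'rV[R]_n} : abs_cont_on a b f ->
  forall e : R, 0 < e -> exists2 d : R, 0 < d &
    forall s t, a <= s <= b -> a <= t <= b -> `|s - t| < d -> `|f s - f t| < e.
Proof.
move=> acf e /acf[d d0 Hd]; exists d => //.
suff H s t : a <= s -> t <= b -> s <= t -> t - s < d -> `|f t - f s| < e.
  move=> s t /andP[? ?] /andP[? ?].
  have [st|ts] := leP s t.
    by rewrite ler0_norm ?subr_le0 // opprB distrC => ?; apply: H.
  by rewrite gtr0_norm ?subr_gt0 // => ?; apply: H => //; exact: ltW.
move=> as_ tb st tsd; have := Hd 1 (fun=> s) (fun=> t).
rewrite !big_ord1; apply => // k k'; by rewrite !ord1 eqxx.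
Qed.

Lemma sol_domain_ge0 {R : realType} {D : set R} {t : R} :
  sol_domain D -> D t -> 0 <= t.
Proof.
by case=> -[T [T0 ->]] /=; [rewrite in_itv /= => /andP[]|case].
Qed.

Lemma sol_domain_down {R : realType} {D : set R} {s t : R} :
  sol_domain D -> 0 <= s <= t -> D t -> D s.
Proof.
move=> + /andP[s0 st]; case=> -[T [T0 ->]] /=.
  by rewrite !in_itv /= s0 => /andP[_]; exact: le_trans.
by move=> [t0 tT]; split => //; apply: le_lt_trans tT; rewrite lee_fin.
Qed.

(** Serves to recognise the union of a chain of domains as a domain. Either [D] is empty, which is
    [[0, 0)], or it is unbounded, or it has a supremum that it contains or misses. *)
Lemma sol_domainI {R : realType} (D : set R) :
  (forall t, D t -> 0 <= t) -> (forall s t, 0 <= s <= t -> D t -> D s) ->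
  sol_domain D.
Proof.
move=> D0 Ddown.
have [[t0 Dt0]|nD] := pselect (exists t, D t); last first.
  right; exists 0%E; split => //; apply/seteqP; split => t.
    by move=> Dt; case: nD; exists t.
  by move=> [t0]; rewrite lte_fin ltNge t0.
have [ubD|nubD] := pselect (has_ubound D); last first.
  right; exists +oo%E; split => //; apply/seteqP; split => t.
    by move=> Dt; split; [exact: D0|rewrite ltry].
  move=> [t0' _]; apply: contrapT => nDt; apply: nubD; exists t => s Ds.
  rewrite leNgt; apply/negP => ts; apply: nDt.
  by apply: Ddown Ds; rewrite t0' ltW.
have supD : has_sup D by split => //; exists t0.
have s0 : 0 <= sup D by apply: le_trans (D0 _ Dt0) _; exact: sup_upper_bound.
have [DS|nDS] := pselect (D (sup D)).
  left; exists (sup D); split => //; apply/seteqP; split => t /=; rewrite in_itv /=.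
    by move=> Dt; rewrite D0 //; exact: sup_upper_bound.
  by move=> h; exact: Ddown DS.
right; exists (sup D)%:E; split; first by rewrite lee_fin.
apply/seteqP; split => t /=; rewrite lte_fin.
  move=> Dt; split; first exact: D0.
  rewrite lt_neqAle; apply/andP; split; last exact: sup_upper_bound.
  by apply: contra_not_neq nDS => <-.
move=> [t0' tS]; have [|s Ds ts] := @sup_adherent _ D (sup D - t) _ supD.
  by rewrite subr_gt0.
by apply: Ddown Ds; rewrite t0' /=; lra.
Qed.

(** A fundamental theorem of calculus without integrals: on short intervals around [t], the mean
    value estimate with [w = g t] is the definition of the derivative. It applies both to solutions
    and to curves glued from two pieces. *)
Lemma is_derive_mean_value {R : realType} {n : nat} {gam g : R -> 'rV[R]_n}
    {a b t : R} :
  a < t < b ->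
  (forall u v w eta, a <= u -> u <= v -> v <= b ->
     (forall s, u <= s <= v -> `|g s - w| <= eta) ->
     `|gam v - gam u - (v - u) *: w| <= eta * (v - u)) ->
  (forall e : R, 0 < e -> exists2 d : R, 0 < d &
     forall s, a <= s <= b -> `|s - t| < d -> `|g s - g t| <= e) ->
  is_derive t (1 : R) gam (g t).
Proof.
move=> /andP[at_ tb] mv cg; apply/is_derive_epsP => e e0.
have [d d0 Hd] := cg e e0.
exists (Num.min d (Num.min (t - a) (b - t))).
  by rewrite !lt_min d0 /= !subr_gt0 at_.
move=> h; rewrite !lt_min => /andP[hd /andP[ha hb]]; rewrite scaler1.
move: ha hb hd; rewrite !ltr_norml => /andP[? ?] /andP[? ?] /andP[? ?].
have [h0|h0] := leP 0 h.
  have := mv t (h + t) (g t) e; rewrite addrK [`|h|]ger0_norm //; apply; try lra.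
  by move=> s /andP[? ?]; apply: Hd; [|rewrite ltr_norml]; apply/andP; split; lra.
have := mv (h + t) t (g t) e.
rewrite [`|h|]ltr0_norm // (_ : t - (h + t) = - h); last by ring.
rewrite -[`|gam (h + t) - _ - _|]normrN.
have -> : - (gam (h + t) - gam t - h *: g t) = gam t - gam (h + t) - (- h) *: g t.
  by apply/rowP => i; rewrite !mxE; ring.
apply; try lra.
by move=> s /andP[? ?]; apply: Hd; [|rewrite ltr_norml]; apply/andP; split; lra.
Qed.

Lemma solution_mean_value {R : realType} {n : nat} {F : 'rV[R]_n -> 'rV[R]_n}
    {D : set R} {x : R -> 'rV[R]_n} {u v eta : R} {w : 'rV[R]_n} :
  is_solution F D x -> 0 <= u -> u <= v -> D v ->
  (forall s, u <= s <= v -> `|F (x s) - w| <= eta) ->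
  `|x v - x u - (v - u) *: w| <= eta * (v - u).
Proof.
move=> [sD [acx aex]] u0 uv Dv Hw.
apply: abs_cont_mean_value => //.
- by apply: le_trans (Hw u _); rewrite ?lexx.
- by apply: abs_cont_onW (acx v Dv).
apply: negligibleS aex => t nH H; apply: nH => /andP[ut tv]; exists (F (x t)).
  by apply: H; apply: sol_domain_down Dv => //; rewrite (le_trans u0).
by apply: Hw; rewrite ut.
Qed.

(** Continuity of [F (x s)] in [s] upgrades almost everywhere to everywhere in the interior. The
    point [t'] keeps [t] off the right end of [D], beyond which [x] is arbitrary. *)
Lemma solution_is_derive {R : realType} {n : nat} {F : 'rV[R]_n -> 'rV[R]_n}
    {D : set R} {x : R -> 'rV[R]_n} {t t' : R} :
  continuous F -> is_solution F D x -> 0 < t -> t < t' -> D t' ->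
  is_derive t (1 : R) x (F (x t)).
Proof.
move=> cF solx t0 tt' Dt'; have [sD [acx _]] := solx.
apply: (@is_derive_mean_value R n x (fun s => F (x s)) 0 t').
- by rewrite t0.
- move=> u v w eta u0 uv vt'; apply: (solution_mean_value solx) => //.
  by apply: sol_domain_down Dt' => //; rewrite vt' (le_trans u0).
move=> e e0.
have /cvgrPdist_lt/(_ e e0)/nbhs_ballP[r /= r0 Hr] := cF (x t).
have [d d0 Hd] := abs_cont_on_dist (acx _ Dt') r r0.
exists d => // s st' sd; rewrite distrC; apply/ltW/Hr.
rewrite /= -ball_normE /= distrC; apply: Hd => //.
by rewrite !ltW.
Qed.

(** The two-sided derivative can fail only at 0 and at the maximum of [D], if there is one: a null
    set. *)
Lemma classical_is_solution {R : realType} {n : nat} {F : 'rV[R]_n -> 'rV[R]_n}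
    {D : set R} {x : R -> 'rV[R]_n} :
  sol_domain D -> (forall b, D b -> abs_cont_on 0 b x) ->
  (forall t t', 0 < t -> t < t' -> D t' -> is_derive t (1 : R) x (F (x t))) ->
  is_solution F D x.
Proof.
move=> sD acx dx; do !split => //.
have neg1 (a : R) : (@lebesgue_measure R).-negligible [set a].
  by apply/negligibleP => //; exact: lebesgue_measure_set1.
have [[m [Dm mD]]|nomax] := pselect (exists m, D m /\ forall t, D t -> t <= m).
  apply: negligibleS (negligibleU (neg1 0) (neg1 m)) => t /=.
  move/not_implyP => [Dt ndx].
  have := sol_domain_ge0 sD Dt; rewrite le_eqVlt => /orP[/eqP <-|t0]; first by left.
  right; apply/eqP; rewrite eq_le mD //= leNgt; apply/negP => tm.
  exact/ndx/(dx t m).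
apply: negligibleS (neg1 0) => t /=.
move/not_implyP => [Dt ndx].
have := sol_domain_ge0 sD Dt; rewrite le_eqVlt => /orP[/eqP <- //|t0].
exfalso; apply: nomax; exists t; split => // t' Dt'; rewrite leNgt.
by apply/negP => tt'; exact/ndx/(dx t t').
Qed.

(** * Maps with continuous partial derivatives *)

Lemma is_derive_line {R : realFieldType} {V W : normedModType R} (f : V -> W)
    (q v : V) (s : R) (df : W) :
  is_derive (s *: v + q) v f df <->
  is_derive s (1 : R) (fun s => f (s *: v + q)) df.
Proof.
by rewrite !is_derive_epsP; split=> H e e0; have [d d0 Hd] := H e e0;
  exists d => // h hd; have := Hd h hd; rewrite scaler1 scalerDl addrA.
Qed.

Lemma directional_mean_value {R : realType} {V : normedModType R} {f : V -> R}
    {q v : V} {h c e : R} :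
  (forall s : R, `|s| <= `|h| -> derivable f (s *: v + q) v /\
     `|'D_v f (s *: v + q) - c| <= e) ->
  `|f (h *: v + q) - f q - h * c| <= `|h| * e.
Proof.
move=> H; pose g (s : R) := f (s *: v + q).
pose dg (s : R) := 'D_v f (s *: v + q).
have gq : f q = g 0 by rewrite /g scale0r add0r.
have dgP (s : R) : `|s| <= `|h| -> is_derive s (1 : R) g (dg s).
  by move=> /H[? _]; apply/is_derive_line/derivableP.
have key (a b : R) : a <= b -> (forall s, a <= s <= b -> `|s| <= `|h|) ->
    exists2 s, `|s| <= `|h| & g b - g a = dg s * (b - a).
  move=> ab Hab; have [||s] := @MVT_segment R g dg a b ab.
  - by move=> s; rewrite in_itv /= => /andP[? ?]; apply/dgP/Hab; rewrite !ltW.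
  - apply: derivable_within_continuous => s; by rewrite in_itv /= => /Hab/dgP[].
  by rewrite in_itv /= => /Hab ? ?; exists s.
have dgc s : `|s| <= `|h| -> `|h * (dg s - c)| <= `|h| * e.
  by move=> /H[_ ?]; rewrite normrM ler_wpM2l.
rewrite gq -/(g h); have [h0|h0] := leP 0 h.
  have [|s sh ->] := key 0 h h0.
    by move=> s /andP[? ?]; rewrite !ger0_norm //; lra.
  by have := dgc s sh; congr (`|_| <= _); ring.
have [|s sh gE] := key h 0 (ltW h0).
  by move=> s /andP[? ?]; rewrite !ler0_norm //; lra.
have := dgc s sh; congr (`|_| <= _).
by rewrite -[g h - g 0]opprB gE; ring.
Qed.

(** Moves along one direction at a time; the sum of the step lengths keeps the broken path in the
    ball. With [c = 0] it yields Lipschitz bounds, with [c] the partial derivatives at [p] it yields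
    the chain rule. *)
Lemma partials_mean_value {R : realType} {V : normedModType R} {I : eqType}
    {f : V -> R} {s : seq I} {h c e : I -> R} {v : I -> V} {p q : V} {r : R} :
  (forall i z, i \in s -> `|z - p| < r ->
     derivable f z (v i) /\ `|'D_(v i) f z - c i| <= e i) ->
  `|q - p| + \sum_(i <- s) `|h i| * `|v i| < r ->
  `|f (q + \sum_(i <- s) h i *: v i) - f q - \sum_(i <- s) h i * c i|
    <= \sum_(i <- s) `|h i| * e i.
Proof.
elim: s q => [|i s IH] q H.
  by rewrite !big_nil => _; rewrite addr0 subrr subr0 normr0.
rewrite !big_cons => qr.
have S0 : 0 <= \sum_(j <- s) `|h j| * `|v j|.
  by apply: sumr_ge0 => j _; rewrite mulr_ge0.
have hv0 : 0 <= `|h i| * `|v i| by rewrite mulr_ge0.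
have IHs : (forall j z, j \in s -> `|z - p| < r ->
    derivable f z (v j) /\ `|'D_(v j) f z - c j| <= e j).
  by move=> j z js; apply: H; rewrite inE js orbT.
have qp (k : R) : `|k| <= `|h i| -> `|k *: v i + q - p| <= `|q - p| + `|h i| * `|v i|.
  move=> kh; rewrite -addrA addrC; apply: le_trans (ler_normD _ _) _.
  by rewrite lerD2l normrZ ler_wpM2r.
have step1 : `|f (h i *: v i + q) - f q - h i * c i| <= `|h i| * e i.
  apply: directional_mean_value => k kh; apply: H; first by rewrite mem_head.
  by apply: le_lt_trans (qp k kh) _; lra.
have qph := qp (h i) (lexx _).
have := IH (h i *: v i + q) IHs; rewrite [q + _]addrA [q + _]addrC => step2.
have {}step2 := step2 ltac:(lra).
set A := f (_ + _) in step2 *; set S := \sum_(_ <- _) _ * c _ in step2 *.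
have -> : A - f q - (h i * c i + S) =
  (f (h i *: v i + q) - f q - h i * c i) + (A - f (h i *: v i + q) - S) by ring.
apply: le_trans (ler_normD _ _) _; exact: lerD.
Qed.

Lemma coord_le_norm {R : realType} {n : nat} (v : 'rV[R]_n) (i : 'I_n) :
  `|v 0 i| <= `|v|.
Proof.
rewrite [leRHS]/Num.norm /= mx_normrE; apply: le_trans; last exact: (le_bigmax _ _ (0, i)).
by [].
Qed.

Lemma norm_row_le {R : realType} {n : nat} (v : 'rV[R]_n) (M : R) :
  0 <= M -> (forall i, `|v 0 i| <= M) -> `|v| <= M.
Proof.
move=> M0 H; rewrite [leLHS]/Num.norm /= mx_normrE (bigmax_le _ M0) //= => -[i j] _ /=.
by rewrite ord1 H.
Qed.

Lemma norm_basis_vec {R : realType} {n : nat} (i : 'I_n) :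
  `|basis_vec R i| <= 1.
Proof.
apply: norm_row_le => // j; rewrite mxE eqxx /=.
by case: (_ == _); rewrite ?normr1 ?normr0.
Qed.

Lemma continuous_compact_bounded {R : realType} {T : topologicalType}
    {V : normedModType R} {g : T -> V} {K : set T} :
  compact K -> {in K, continuous g} -> exists2 M : R, 0 <= M & forall z, K z -> `|g z| <= M.
Proof.
move=> cK cg; have cgK : compact (g @` K).
  by apply: continuous_compact => //; exact: continuous_in_subspaceT.
have /compact_bounded[M [Mr HM]] := cgK.
exists (`|M| + 1); first by rewrite addr_ge0.
move=> z Kz; apply: (HM (`|M| + 1)).
  by rewrite (le_lt_trans (ler_norm _)) // ltrDl.
by exists z.
Qed.

Lemma compact_closed_ball {R : realType} {n : nat} (r : R) :
  compact [set z : 'rV[R]_n | `|z| <= r].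
Proof.
apply: bounded_closed_compact.
  by exists r; split; [exact: num_real|move=> M rM z /= zr; exact: le_trans zr (ltW rM)].
apply: (@closed_comp _ _ (fun z : 'rV[R]_n => `|z|) [set y : R | y <= r]).
  by move=> z _; exact: norm_continuous.
exact: closed_le.
Qed.

Lemma C1_map_lipschitz {R : realType} {n : nat} {F : 'rV[R]_n -> 'rV[R]_n}
    (r : R) : C1_map F ->
  exists2 L : R, 0 <= L & forall x y, `|x| <= r -> `|y| <= r ->
    `|F x - F y| <= L * `|x - y|.
Proof.
move=> C1F.
(* The path from [y] to [x] makes [n] coordinate steps of length at most [r + r], so it stays inside
   this radius, strictly because of the 1. *)
pose r' := (r + r) *+ n + r + 1.
have /choice[M HM] : forall i : 'I_n, exists M : R, 0 <= M /\
    forall z, `|z| <= r' -> `|'D_(basis_vec R i) F z| <= M.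
  move=> i; have [M M0 HM] := @continuous_compact_bounded R _ _
    ('D_(basis_vec R i) F) _ (@compact_closed_ball R n r') (in1W (C1F i).2).
  by exists M; split.
have M0 i : 0 <= M i by have [] := HM i.
exists (\sum_(i < n) M i); first exact: sumr_ge0.
move=> x y xr yr; have r0 : 0 <= r by exact: le_trans xr.
have xy : `|x - y| <= r + r by apply: le_trans (ler_normB _ _) _; exact: lerD.
apply: norm_row_le => [|k]; first by rewrite mulr_ge0 // sumr_ge0.
have := @partials_mean_value R _ _ (fun z => F z 0 k) (enum 'I_n)
  (fun i => (x - y) 0 i) (fun=> 0) M (@basis_vec R n) 0 y r'.
rewrite !big_enum /=.
have -> : y + \sum_(i < n) (x - y) 0 i *: basis_vec R i = x.
  by rewrite -row_sum_delta addrC subrK.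
have -> : \sum_(i < n) (x - y) 0 i * 0 = 0 by rewrite big1 // => i _; rewrite mulr0.
rewrite !subr0 => H; rewrite !mxE.
apply: le_trans (H _ _) _.
- move=> i z _; rewrite !subr0 => zr'; have /derivable_mxP dF := (C1F i).1 z.
  split; first exact: dF.
  apply: le_trans ((HM i).2 z (ltW zr')).
  apply: le_trans (coord_le_norm _ k); rewrite derive_mx ?mxE //.
  exact: (C1F i).1.
- rewrite /r' addrC.
  apply: (@le_lt_trans _ _ ((r + r) *+ n + r)); last by lra.
  apply: lerD => //.
  rewrite -[n in _ *+ n]card_ord -sumr_const; apply: ler_sum => i _.
  rewrite -[leRHS]mulr1; apply: ler_pM => //; last exact: norm_basis_vec.
  exact: le_trans (coord_le_norm _ _) _.
rewrite mulr_suml; apply: ler_sum => i _; rewrite mulrC ler_wpM2l //.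
exact: coord_le_norm.
Qed.

Lemma C1_map_continuous {R : realType} {n : nat} {F : 'rV[R]_n -> 'rV[R]_n} :
  C1_map F -> continuous F.
Proof.
move=> C1F x; apply: (iffRL (@cvgrPdist_le _ _ _ (nbhs x) _ F (F x))) => e e0.
have [L L0 HL] := C1_map_lipschitz (`|x| + 1) C1F.
apply/nbhs_ballP; exists (Num.min 1 (e / (L + 1))).
  by rewrite /= lt_min ltr01 divr_gt0 // ltr_wpDl.
move=> y; rewrite -ball_normE /= lt_min => /andP[xy1 xye].
have y1 : `|y| <= `|x| + 1.
  by have := ler_distD 0 x y; have := ler_normB x (x - y); rewrite subKr; lra.
apply: le_trans (HL x y _ y1) _; first by rewrite lerDl.
move: xye; rewrite ltr_pdivlMr ?ltr_wpDl // => xye.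
have := normr_ge0 (x - y); lra.
Qed.

Lemma sum_xdir {R : realType} {n : nat} (h : 'rV[R]_n) :
  \sum_(i < n) h 0 i *: xdir R i = (0, h).
Proof.
rewrite [in RHS](row_sum_delta h).
elim/big_ind2 : _ => // [a1 b1 a2 b2 -> ->|i _].
  by congr (_, _) => /=; rewrite addr0.
by congr (_, _) => /=; rewrite scaler0.
Qed.

(** A single finite index type for all partial derivatives, [None] being time, so that bounds and
    limits are taken over time and space together. *)
Definition coord_dir (R : realType) (n : nat) (o : option 'I_n) :
  R * 'rV[R]_n := if o is Some i then xdir R i else tdir R n.

Lemma norm_coord_dir {R : realType} {n : nat} (o : option 'I_n) :
  `|coord_dir R n o| <= 1.
Proof.
case: o => [i|]; rewrite /= [leLHS]/Num.norm /= ge_max normr0.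
  by rewrite ler01 norm_basis_vec.
by rewrite normr1 lexx ler01.
Qed.

Lemma C1_on_open_coord_dir {R : realType} {n : nat} {U : set (R * 'rV[R]_n)}
    {f : R * 'rV[R]_n -> R} (o : option 'I_n) {p : R * 'rV[R]_n} :
  C1_on_open U f -> U p -> derivable f p (coord_dir R n o) /\
    {for p, continuous ('D_(coord_dir R n o) f)}.
Proof.
by move=> [_ C1f]; apply: C1f; case: o => [i|]; [right; exists i|left].
Qed.

(** Chain rule obtained directly from continuity of the partial derivatives: they vary by at most
    [e1] along the coordinate path to [(k + t, x (k + t))], and replacing the increment of [x] by
    [k *: w] costs [e2] times their size. *)
Lemma C1_curve_derive {R : realType} {n : nat} {U : set (R * 'rV[R]_n)}
    {f : R * 'rV[R]_n -> R} {x : R -> 'rV[R]_n} {t : R} {w : 'rV[R]_n} :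
  C1_on_open U f -> U (t, x t) -> is_derive t (1 : R) x w ->
  is_derive t (1 : R) (fun s => f (s, x s))
    ('D_(tdir R n) f (t, x t) + \sum_(i < n) 'D_(xdir R i) f (t, x t) * w 0 i).
Proof.
move=> C1f Up dx; set p := (t, x t) in Up *.
pose c o := 'D_(coord_dir R n o) f p.
rewrite -[X in X + _]/(c None) -[X in _ + X]/(\sum_(i < n) c (Some i) * w 0 i).
apply/is_derive_epsP => e e0.
(* Per unit of [|k|], [W] bounds the increment of the curve and [N] the sum of all coordinate
   increments. Each of [e1] and [e2] spends half of [e]. *)
pose W := `|w| + 1; pose N := 1 + W *+ n; pose C := \sum_(i < n) `|c (Some i)|.
have W0 : 0 < W by rewrite ltr_wpDl.
have N0 : 0 < N by rewrite ltr_pwDl // mulrn_wge0 // ltW.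
have C0 : 0 <= C by exact: sumr_ge0.
pose e1 := e / 2 / N; have e10 : 0 < e1 by rewrite !divr_gt0.
pose e2 := Num.min 1 (e / 2 / (C + 1)).
have C10 : 0 < C + 1 by rewrite ltr_wpDl.
have e20 : 0 < e2 by rewrite lt_min ltr01 !divr_gt0.
have : \forall z \near p, U z /\ forall o, `|'D_(coord_dir R n o) f z - c o| <= e1.
  apply: filterI; first by apply: open_nbhs_nbhs; split => //; exact: C1f.1.
  apply: (@filter_forall _ _ (fun o z => `|'D_(coord_dir R n o) f z - c o| <= e1) (nbhs p)) => o.
  have [_ /cvgrPdist_le/(_ e1 e10)] := C1_on_open_coord_dir o C1f Up.
  by apply: filterS => z; rewrite distrC.
move=> /nbhs_ballP[r /= r0 Hr].
have [d d0 Hd] := (is_derive_epsP _ _ _ _ _ _ _).1 dx e2 e20.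
exists (Num.min d (r / N)); first by rewrite lt_min d0 divr_gt0.
move=> k; rewrite lt_min ltr_pdivlMr // => /andP[/Hd kd kr].
rewrite scaler1 in kd *; rewrite -[k *: _]/(k * _).
pose h := x (k + t) - x t.
have hk i : `|h 0 i - k * w 0 i| <= e2 * `|k|.
  have := le_trans (coord_le_norm _ i) kd.
  by rewrite !mxE.
have hW : `|h| <= W * `|k|.
  rewrite -[h](subrK (k *: w)); apply: le_trans (ler_normD _ _) _.
  have : e2 * `|k| <= `|k|.
    by rewrite -[leRHS]mul1r ler_wpM2r // ge_min lexx.
  rewrite normrZ /W mulrDl mul1r [`|w| * _]mulrC; move: kd; rewrite -/h; lra.
pose s := None :: [seq Some i | i <- enum 'I_n].
pose hh o := if o is Some i then h 0 i else k.
have sumN (F : option 'I_n -> R) : \sum_(o <- s) F o = F None + \sum_(i < n) F (Some i).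
  by rewrite big_cons big_map big_enum.
have := @partials_mean_value R _ _ f s hh c (fun=> e1) (coord_dir R n) p p r.
have -> : p + \sum_(o <- s) hh o *: coord_dir R n o = (k + t, x (k + t)).
  rewrite big_cons big_map big_enum /= sum_xdir /p /h.
  by congr (_, _) => /=; [rewrite [k *: 1]mulr1 addr0 addrC|
    rewrite scaler0 add0r addrC subrK].
rewrite !sumN subrr normr0 add0r /=.
have sumhh : `|k| + \sum_(i < n) `|h 0 i| <= N * `|k|.
  rewrite mulrDl mul1r lerD2l.
  have -> : W *+ n * `|k| = \sum_(i < n) W * `|k|.
    by rewrite sumr_const card_ord mulrnAl.
  by apply: ler_sum => i _; apply: le_trans hW; exact: coord_le_norm.
have A1 (o : option 'I_n) z : o \in s -> `|z - p| < r -> derivable f z (coord_dir R n o) /\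
    `|'D_(coord_dir R n o) f z - c o| <= e1.
  move=> _ zp; have [|Uz Hz] := Hr z; first by rewrite -ball_normE /= distrC.
  by split; [exact: (C1_on_open_coord_dir o C1f Uz).1|exact: Hz].
have A2 : `|k| * `|tdir R n| + \sum_(i < n) `|h 0 i| * `|xdir R i| < r.
  apply: le_lt_trans kr; rewrite [leRHS]mulrC; apply: le_trans sumhh.
  apply: lerD => [|].
    by rewrite -[leRHS]mulr1 ler_wpM2l // (@norm_coord_dir R n None).
  apply: ler_sum => i _.
  by rewrite -[leRHS]mulr1 ler_wpM2l // (@norm_coord_dir R n (Some i)).
move=> /(_ A1 A2); rewrite -mulr_suml -mulrDl => H1.
have H2 : `|\sum_(i < n) (h 0 i - k * w 0 i) * c (Some i)| <= e / 2 * `|k|.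
  apply: le_trans (ler_norm_sum _ _ _) _.
  apply: (@le_trans _ _ (\sum_(i < n) e2 * `|k| * `|c (Some i)|)).
    by apply: ler_sum => i _; rewrite normrM ler_wpM2r.
  rewrite -mulr_sumr -/C mulrAC ler_wpM2r //.
  have : e2 * (C + 1) <= e / 2 by rewrite -ler_pdivlMr // ge_min lexx orbT.
  have := ltW e20; lra.
have -> : f (k + t, x (k + t)) - f (t, x t) -
    k * (c None + \sum_(i < n) c (Some i) * w 0 i) =
  (f (k + t, x (k + t)) - f p - (k * c None + \sum_(i < n) h 0 i * c (Some i)))
  + \sum_(i < n) (h 0 i - k * w 0 i) * c (Some i).
  have -> : \sum_(i < n) (h 0 i - k * w 0 i) * c (Some i) =
     \sum_(i < n) h 0 i * c (Some i) - k * \sum_(i < n) c (Some i) * w 0 i.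
    by rewrite mulr_sumr -sumrB; apply: eq_bigr => i _; ring.
  by rewrite /p; ring.
apply: le_trans (ler_normD _ _) _.
have H3 : (`|k| + \sum_(i < n) `|h 0 i|) * e1 <= e / 2 * `|k|.
  apply: le_trans (_ : N * `|k| * e1 <= _); first by rewrite ler_wpM2r // ltW.
  by rewrite /e1 mulrC mulrA divfK ?gt_eqF.
lra.
Qed.

(** * Barriers imply safety *)

Lemma within_continuous_epsP {R : realType} {V W : normedModType R}
    {A : set V} {f : V -> W} :
  {within A, continuous f} <-> forall x (e : R), A x -> 0 < e ->
    exists2 d : R, 0 < d & forall y, A y -> `|y - x| < d -> `|f y - f x| < e.
Proof.
split=> [/subspace_continuousP H x e Ax e0|H].
  have /cvgrPdist_lt/(_ e e0) := H x Ax.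
  move=> /nbhs_ballP[d /= d0 Hd]; exists d => // y Ay yx.
  by rewrite distrC; apply: Hd Ay; rewrite -ball_normE /= distrC.
apply/subspace_continuousP => x Ax; apply/cvgrPdist_lt => e e0.
have [d d0 Hd] := H x e Ax e0.
apply/nbhs_ballP; exists d => //= y; rewrite -ball_normE /= => xy Ay.
by rewrite distrC; apply: Hd => //; rewrite distrC.
Qed.

Lemma barrier_safe {R : realType} {n : nat} {F : 'rV[R]_n -> 'rV[R]_n}
    {Xo Xu : set 'rV[R]_n} {B : R * 'rV[R]_n -> R} :
  continuous F -> barrier_candidate Xo Xu B ->
  {within [set p : R * 'rV[R]_n | 0 <= p.1], continuous B} ->
  C1_on [set p | 0 <= p.1 /\ 0 < B p] B ->
  (forall p : R * 'rV[R]_n, 0 <= p.1 -> 0 < B p -> lie_der B F p <= 0) ->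
  safe F Xo Xu.
Proof.
move=> cF [BXu BXo] cB [U [SU C1B]] lieB D x solx D0 Xo0 t Dt Xut.
have [sD [acx _]] := solx.
have t0 := sol_domain_ge0 sD Dt.
pose b s := B (s, x s).
have cb s e : 0 <= s <= t -> 0 < e -> exists2 d : R, 0 < d & forall s',
    0 <= s' <= t -> `|s' - s| < d -> `|b s' - b s| < e.
  move=> /andP[s0 st] e0.
  have Ds := sol_domain_down sD (introT andP (conj s0 st)) Dt.
  have [d d0 Hd] := within_continuous_epsP.1 cB (s, x s) e s0 e0.
  have [d' d'0 Hd'] := abs_cont_on_dist (acx t Dt) d d0.
  exists (Num.min d d'); first by rewrite lt_min d0.
  move=> s' /andP[s'0 s't]; rewrite lt_min => /andP[ss'd ss'd']; apply: Hd => //.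
  rewrite [ltLHS]/Num.norm /= gt_max ss'd /=.
  by apply: Hd' => //; apply/andP.
(* The supremum of [S] is the last time before [t] at which [b] is nonpositive. From then on the
   solution stays outside [K], where the inequality holds. *)
pose S := [set s | 0 <= s <= t /\ b s <= 0].
have S0 : S 0 by split; [rewrite lexx|exact: BXo].
have supS : has_sup S by split; [exists 0|exists t => s [/andP[]]].
set sg := sup S.
have sg0 : 0 <= sg by exact: sup_upper_bound.
have sgt : sg <= t by apply: ge_sup; [exists 0|move=> s [/andP[]]].
have bsg : b sg <= 0.
  rewrite leNgt; apply/negP => bsg0.
  have [|d d0 Hd] := cb sg (b sg) _ bsg0; first exact/andP.
  have [s Ss] := sup_adherent d0 supS; rewrite -/sg => sgs; have [st bs] := Ss.
  have ssg : s <= sg by exact: sup_upper_bound.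
  have := Hd s st; rewrite ler0_norm ?subr_le0 // ltr_norml => /(_ ltac:(lra)).
  by move=> /andP[]; lra.
have bt0 : 0 < b t by exact: BXu.
have {sgt}sgt : sg < t.
  by rewrite lt_neqAle sgt andbT; apply: contraTneq bsg => ->; rewrite -ltNge.
have bpos s : sg < s <= t -> 0 < b s.
  move=> /andP[sgs st]; rewrite ltNge; apply/negP => bs.
  have : s <= sg by apply: sup_upper_bound => //; split => //; apply/andP; split; lra.
  by rewrite leNgt sgs.
(* At [sg] the curve may lie on the boundary of [K], where only continuity of [B] is given; the mean
   value theorem asks for no more at an end point. *)
have [s||s ssgt bE] := @MVT R b (fun s => lie_der B F (s, x s)) sg t sgt.
- rewrite in_itv /= => /andP[sgs st].
  apply: (C1_curve_derive C1B); first by apply: SU; split; [rewrite /=; lra|apply: bpos; rewrite sgs ltW].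
  by apply: (solution_is_derive cF solx _ st Dt); exact: le_lt_trans sgs.
- apply/within_continuous_epsP => s e /=; rewrite in_itv /= => /andP[sgs st] e0.
  have [|d d0 Hd] := cb s e _ e0; first by rewrite (le_trans sg0).
  exists d => // y; rewrite in_itv /= => /andP[sgy yt]; apply: Hd.
  by rewrite (le_trans sg0).
have : lie_der B F (s, x s) * (t - sg) <= 0.
  move: ssgt; rewrite in_itv /= => /andP[sgs st].
  rewrite mulr_le0_ge0 ?subr_ge0 ?(ltW sgt) //; apply: lieB; first by rewrite /=; lra.
  by apply: bpos; rewrite sgs ltW.
by rewrite -bE; lra.
Qed.

(** * Backward trajectories *)

Lemma is_derive_near {R : realType} {n : nat} {f g : R -> 'rV[R]_n} {t a b : R}
    {df : 'rV[R]_n} :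
  a < t < b -> (forall s, a < s < b -> f s = g s) ->
  is_derive t (1 : R) f df -> is_derive t (1 : R) g df.
Proof.
move=> tab fg /is_derive_epsP df_; apply/is_derive_epsP => e e0.
have [d d0 Hd] := df_ e e0; have /andP[at_ tb] := tab.
exists (Num.min d (Num.min (t - a) (b - t))).
  by rewrite !lt_min d0 /= !subr_gt0 at_.
move=> h; rewrite !lt_min => /andP[hd /andP[ha hb]].
have := Hd h hd; rewrite scaler1 !fg //.
by move: ha hb; rewrite !ltr_norml => /andP[? ?] /andP[? ?]; apply/andP; split; lra.
Qed.

(** Existence is drawn from completeness itself: Zorn's lemma extends the constant solution on
    [[0, 0]] to a maximal one, whose domain is unbounded and downward closed, hence all of
    [[0, oo)]. *)
Lemma global_solution {R : realType} {n : nat} {G : 'rV[R]_n -> 'rV[R]_n}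
    (x0 : 'rV[R]_n) : continuous G -> forward_complete G ->
  exists2 z : R -> 'rV[R]_n, z 0 = x0 & is_solution G [set t | 0 <= t] z.
Proof.
move=> cG fcG.
pose ok (p : set R * (R -> 'rV[R]_n)) :=
  [/\ is_solution G p.1 p.2, p.1 0 & p.2 0 = x0].
pose ext (p q : set R * (R -> 'rV[R]_n)) :=
  p.1 `<=` q.1 /\ forall t, p.1 t -> q.2 t = p.2 t.
pose T := {p | ok p}; pose le (p q : T) := `[< ext (sval p) (sval q) >].
have ok0 : ok (`[0, 0]%classic, cst x0).
  split => //=; last by rewrite in_itv /= lexx.
  apply: classical_is_solution; first by left; exists 0.
    move=> b _ e e0; exists 1 => // m l r _ _ _.
    by rewrite big1 // => k _; rewrite subrr normr0.
  by move=> t t' t0 tt' /=; rewrite in_itv /= => /andP[_]; lra.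
(* Only a preorder: two functions that agree on their common domain may still differ off it. *)
have [|||[[D z] /= [solz D0 z0]] premax] := @ZL_preorder T (exist _ _ ok0) le.
- by move=> p; apply/asboolP; split.
- move=> p q r /asboolP[pq pqE] /asboolP[qr qrE]; apply/asboolP; split.
    exact: subset_trans qr.
  by move=> t pt; rewrite qrE ?pqE //; exact: pq.
- move=> A totA.
  have [[i0 Ai0]|nA] := pselect (exists i, A i); last first.
    by exists (exist _ _ ok0) => i Ai; case: nA; exists i.
  pose D t := exists2 i, A i & (sval i).1 t.
  (* All members of the chain defined at [t] agree there; 0 is a default where none is. *)
  have zex t : exists v, forall i, A i -> (sval i).1 t -> (sval i).2 t = v.
    have [[i Ai Dit]|nD] := pselect (D t); last first.
      by exists 0 => i Ai Dit; case: nD; exists i.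
    exists ((sval i).2 t) => j Aj Djt.
    by have [/asboolP[_ ->]|/asboolP[_ ->]] := totA _ _ Ai Aj.
  have [z zE] := choice zex.
  have sDi (i : T) : sol_domain (sval i).1 by case: i => p /= [[]].
  have okz : ok (D, z).
    split => /=; last first.
    - by rewrite -(zE 0 i0) //; case: (i0) => p /= [].
    - by exists i0 => //; case: (i0) => p /= [].
    apply: classical_is_solution.
    - apply: sol_domainI => [t [i _]|s t st [i Ai Dit]]; first exact: sol_domain_ge0.
      by exists i => //; exact: sol_domain_down Dit.
    - move=> b [i Ai Dib]; apply: (@eq_abs_cont_on _ _ _ _ (sval i).2).
        by move=> t tb; apply: zE => //; exact: sol_domain_down Dib.
      by case: (i) Dib => p /= [[_ [+ _]] _ _]; exact.
    - move=> t t' t0 tt' [i Ai Dit'].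
      have Dis s : 0 < s < t' -> (sval i).1 s.
        by move=> /andP[? ?]; apply: sol_domain_down Dit' => //; rewrite !ltW.
      have t0t' : 0 < t < t' by rewrite t0.
      rewrite -(zE t i Ai (Dis t t0t')).
      apply: (is_derive_near t0t' (f := (sval i).2)) => [s st'|].
        by apply: zE => //; exact: Dis.
      by case: (i) Dit' => p /= [solp _ _] Dp; exact: (solution_is_derive cG solp t0 tt').
  exists (exist _ _ okz) => i Ai; apply/asboolP; split => /= [t Dit|t Dit].
    by exists i.
  by rewrite -(zE t i).
have sD : sol_domain D by have [] := solz.
have max : maximal_solution G D z.
  split => // -[D' [y [soly [DD' [neD yz]]]]].
  have oky : ok (D', y) by split => //=; [exact: DD'|rewrite yz].
  have /premax/asboolP[D'D _] : le (exist _ (D, z) (And3 solz D0 z0))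
    (exist _ (D', y) oky) by apply/asboolP; split.
  by move/eqP: neD; apply; apply/seteqP; split.
have DE : D = [set t | 0 <= t].
  apply/seteqP; split => t /=; first exact: sol_domain_ge0.
  move=> t0; apply: contrapT => nDt; apply: (fcG D z max); exists t => s Ds.
  rewrite leNgt; apply/negP => ts; apply: nDt.
  by apply: sol_domain_down Ds => //; rewrite t0 ltW.
by exists z => //; rewrite -DE.
Qed.

Lemma is_derive_reflect {R : realType} {n : nat} {f : R -> 'rV[R]_n} {c t : R}
    {df : 'rV[R]_n} : is_derive (c - t) (1 : R) f df ->
  is_derive t (1 : R) (fun s => f (c - s)) (- df).
Proof.
move=> /is_derive_epsP df_; apply/is_derive_epsP => e e0.
have [d d0 Hd] := df_ e e0; exists d => // h hd.
have := Hd (- h); rewrite normrN => /(_ hd); rewrite !scaler1 scalerN scaleNr.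
by have -> : - h + (c - t) = c - (h + t) by ring.
Qed.

(** Time reversal of a global solution of the system with [- F]. The derivative [g] is returned
    separately from [F] because the two part ways after [t1]. *)
Lemma backward_curve {R : realType} {n : nat} {F : 'rV[R]_n -> 'rV[R]_n}
    {Xo Xu : set 'rV[R]_n} {t1 : R} {x1 : 'rV[R]_n} :
  continuous F -> backward_complete F -> safe F Xo Xu -> 0 <= t1 -> Xu x1 ->
  exists gam g : R -> 'rV[R]_n,
    [/\ continuous g, forall s, is_derive s (1 : R) gam (g s),
        forall s, s <= t1 -> g s = F (gam s),
        forall s, t1 <= s -> g s = F x1 /\ gam s = (s - t1) *: F x1 + x1 &
        forall s, 0 <= s <= t1 -> ~ Xo (gam s)].
Proof.
move=> cF bcF safeF t10 Xux1.
have cNF : continuous (fun z => - F z) by move=> z; apply: continuousN; exact: cF.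
have [z z0 solz] := global_solution x1 cNF bcF.
have [_ [acz _]] := solz.
(* Freezing time at [t1] makes [F (y s)] continuous across [t1] and equal to the slope of the
   tangent line beyond it. *)
pose y s := z (Num.max 0 (t1 - s)).
have yE s : s <= t1 -> y s = z (t1 - s) by move=> ?; rewrite /y max_r ?subr_ge0.
have yt1 s : t1 <= s -> y s = x1 by move=> ?; rewrite /y max_l ?subr_le0.
pose gam s := if s <= t1 then z (t1 - s) else (s - t1) *: F x1 + x1.
have gamE s : t1 <= s -> gam s = (s - t1) *: F x1 + x1.
  rewrite /gam => ts; case: leP => // st.
  have -> : s = t1 by apply/eqP; rewrite eq_le st.
  by rewrite subrr z0 scale0r add0r.
have gamz s : s <= t1 -> gam s = z (t1 - s) by rewrite /gam => ->.
have cy : continuous y.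
  move=> s; apply: (iffRL (@cvgrPdist_lt _ _ _ (nbhs s) _ y (y s))) => e e0.
  have b0 : 0 <= `|t1 - s| + 1 by rewrite addr_ge0.
  have [d d0 Hd] := abs_cont_on_dist (acz (`|t1 - s| + 1) b0) e e0.
  apply/nbhs_ballP; exists (Num.min 1 d); first by rewrite /= lt_min ltr01.
  move=> s'; rewrite -ball_normE /= lt_min => /andP[s1 sd].
  apply: Hd.
  - by rewrite le_max lexx ge_max b0 /=; have := ler_norm (t1 - s); lra.
  - rewrite le_max lexx ge_max b0 /=; have := ler_norm (t1 - s).
    by have := ler_norm (s - s'); lra.
  - apply: le_lt_trans sd.
    have h1 := ler_norm (s - s'); have := ler_norm (s' - s); rewrite distrC => h2.
    by case: (leP 0 (t1 - s)) => ?; case: (leP 0 (t1 - s')) => ?;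
      rewrite ler_norml; apply/andP; split; lra.
(* This estimate adds over adjacent intervals, so splitting at [t1] gives differentiability at the
   junction with no separate argument there. *)
have mv u v w eta : u <= v -> (forall s, u <= s <= v -> `|F (y s) - w| <= eta) ->
    `|gam v - gam u - (v - u) *: w| <= eta * (v - u).
  have mvl u' v' : u' <= v' -> v' <= t1 ->
      (forall s, u' <= s <= v' -> `|F (y s) - w| <= eta) ->
      `|gam v' - gam u' - (v' - u') *: w| <= eta * (v' - u').
    move=> uv vt Huv; rewrite !gamz // ?(le_trans uv) //.
    have := @solution_mean_value R n _ _ z (t1 - v') (t1 - u') eta (- w) solz.
    rewrite subr_ge0 vt => /(_ isT ltac:(lra) ltac:(rewrite /=; lra)).
    have -> : t1 - u' - (t1 - v') = v' - u' by ring.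
    rewrite -normrN => H.
    have -> : z (t1 - v') - z (t1 - u') - (v' - u') *: w =
        - (z (t1 - u') - z (t1 - v') - (v' - u') *: - w).
      by apply/rowP => i; rewrite !mxE; ring.
    apply: H => s /andP[? ?]; rewrite -opprD normrN.
    have := Huv (t1 - s); rewrite yE; last by lra.
    by rewrite subKr; apply; apply/andP; split; lra.
  have mvr u' v' : u' <= v' -> t1 <= u' ->
      (forall s, u' <= s <= v' -> `|F (y s) - w| <= eta) ->
      `|gam v' - gam u' - (v' - u') *: w| <= eta * (v' - u').
    move=> uv tu Huv; rewrite !gamE // ?(le_trans tu) //.
    have -> : (v' - t1) *: F x1 + x1 - ((u' - t1) *: F x1 + x1) - (v' - u') *: w =
      (v' - u') *: (F x1 - w) by apply/rowP => i; rewrite !mxE; ring.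
    rewrite normrZ ger0_norm ?subr_ge0 // mulrC ler_wpM2r ?subr_ge0 //.
    by rewrite -(yt1 u') // Huv // lexx.
  move=> uv Huv; have [vt|tv] := leP v t1; first exact: mvl.
  have [ut|tu] := leP u t1; last by apply: mvr => //; exact: ltW.
  have H1 := mvl u t1 ut (lexx _).
  have H2 := mvr t1 v (ltW tv) (lexx _).
  have -> : gam v - gam u - (v - u) *: w =
     (gam v - gam t1 - (v - t1) *: w) + (gam t1 - gam u - (t1 - u) *: w).
    by apply/rowP => i; rewrite !mxE; ring.
  have -> : eta * (v - u) = eta * (v - t1) + eta * (t1 - u) by ring.
  apply: le_trans (ler_normD _ _) (lerD (H2 _) (H1 _)) => s /andP[? ?];
    apply: Huv; apply/andP; split; lra.
exists gam, (fun s => F (y s)); split.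
- by move=> s; apply: continuous_comp; [exact: cy|exact: cF].
- move=> s; apply: (@is_derive_mean_value _ _ _ (fun s => F (y s)) (s - 1) (s + 1)).
  + by apply/andP; split; lra.
  + by move=> u v w eta _ uv _; exact: mv.
  move=> e e0; have : {for s, continuous (fun s => F (y s))}.
    by apply: continuous_comp; [exact: cy|exact: cF].
  move=> /cvgrPdist_le/(_ e e0)/nbhs_ballP[d /= d0 Hd].
  exists d => // s' _ ss'; rewrite distrC; apply: Hd.
  by rewrite -ball_normE /= distrC.
- by move=> s st; rewrite yE // gamz.
- by move=> s ts; rewrite yt1 // gamE.
move=> s /andP[s0 st]; rewrite gamz // => Xos.
set c := t1 - s in Xos; have c0 : 0 <= c by rewrite subr_ge0.
(* Run forward for time [c], the arc from [gam s] ends at [x1] in [Xu], which contradicts safety. *)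
apply: (safeF `[0, c]%classic (fun s => z (c - s)) _ _ _ c).
- apply: classical_is_solution; first by left; exists c.
    move=> b /=; rewrite in_itv /= => bc.
    by apply: abs_cont_on_reflect => //; exact: acz.
  move=> t t' t0 tt'; rewrite /= in_itv /= => /andP[_ t'c].
  rewrite -[F _]opprK; apply: is_derive_reflect.
  by apply: (solution_is_derive cNF solz (t' := c - t + 1)); rewrite /=; lra.
- by rewrite /= in_itv /= lexx.
- by rewrite subr0.
- by rewrite /= in_itv /= lexx c0.
- by rewrite subrr z0.
Qed.

(** * Tube functions *)

Lemma is_derive_comp1 {R : realType} {V : normedModType R} {f : V -> R}
    {phi : R -> R} {p v : V} {df dphi : R} :
  is_derive p v f df -> is_derive (f p) (1 : R) phi dphi ->
  is_derive p v (fun q => phi (f q)) (dphi * df).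
Proof.
move=> dfp dphi_; have pE : p = 0 *: v + p by rewrite scale0r add0r.
rewrite pE; apply/is_derive_line; rewrite pE in dfp.
move/is_derive_line : dfp => dfp; rewrite pE in dphi_.
exact: (@is_derive1_comp _ phi (fun s => f (s *: v + p)) 0).
Qed.

(** A C^1 function that is positive exactly for u > 0. Both ends of the tube and the bump function
    are made from it. *)
Definition sqpos {R : realType} (u : R) : R := Num.max 0 u ^+ 2.

Lemma sqpos_ge0 {R : realType} (u : R) : 0 <= sqpos u.
Proof. exact: sqr_ge0. Qed.

Lemma is_derive_sqpos {R : realType} (u : R) :
  is_derive u (1 : R) sqpos (2 * Num.max 0 u).
Proof.
apply/is_derive_epsP => e e0; exists e => // h he.
rewrite scaler1 -[h *: _]/(h * _).
have sq : h ^+ 2 <= e * `|h|.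
  by rewrite -(real_normK (num_real h)) expr2 ler_wpM2r // ltW.
have bound : 0 <= sqpos (h + u) - sqpos u - h * (2 * Num.max 0 u) <= h ^+ 2.
  rewrite /sqpos; case: (leP 0 (h + u)) => ?; case: (leP 0 u) => ?;
  apply/andP; split; nra.
by have /andP[? ?] := bound; rewrite ger0_norm //; exact: le_trans sq.
Qed.

Lemma max0_continuous {R : realType} : continuous (fun u : R => Num.max 0 u).
Proof. by move=> u; apply: continuous_max => //; exact: cst_continuous. Qed.

Lemma sqpos_continuous {R : realType} : continuous (@sqpos R).
Proof.
move=> u; apply/differentiable_continuous/derivable1_diffP.
by have [] := is_derive_sqpos u.
Qed.

(* [c * sqpos (t - t1)] closes the tube after [t1] and, for large [c], absorbs
   the error made by extending [gam] linearly there; [sqpos (- t)] closes it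
   before time 0, where nothing is required of the flow derivative. *)
Definition tube_rho {R : realType} {n : nat} (gam : R -> 'rV[R]_n) (a c t1 : R)
    (p : R * 'rV[R]_n) : R :=
  expR (a * (p.1 + 1)) * (\sum_(i < n) (p.2 0 i - gam p.1 0 i) ^+ 2) +
  c * sqpos (p.1 - t1) + sqpos (- p.1).

Definition tube_drho {R : realType} {n : nat} (gam g : R -> 'rV[R]_n)
    (a c t1 : R) (p v : R * 'rV[R]_n) : R :=
  expR (a * (p.1 + 1)) *
    (a * v.1 * (\sum_(i < n) (p.2 0 i - gam p.1 0 i) ^+ 2) +
     \sum_(i < n) 2 * (p.2 0 i - gam p.1 0 i) * (v.2 0 i - v.1 * g p.1 0 i)) +
  c * (2 * Num.max 0 (p.1 - t1) * v.1) - 2 * Num.max 0 (- p.1) * v.1.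

Lemma is_derive_fst {R : realType} {V : normedModType R} (p v : R * V) :
  is_derive p v (fst : R * V -> R) v.1.
Proof.
apply/is_derive_epsP => e e0; exists 1 => // h _ /=.
by rewrite addrK subrr normr0 mulr_ge0 // ltW.
Qed.

Lemma is_derive_coord {R : realType} {n : nat} {gam : R -> 'rV[R]_n} {t : R}
    {w : 'rV[R]_n} (i : 'I_n) :
  is_derive t (1 : R) gam w -> is_derive t (1 : R) (fun s => gam s 0 i) (w 0 i).
Proof.
move=> [dg <-]; rewrite derive_mx // mxE; apply: derivableP.
by move/derivable_mxP : dg; exact.
Qed.

Lemma is_derive_snd_coord {R : realType} {n : nat} (i : 'I_n)
    (p v : R * 'rV[R]_n) :
  is_derive p v (fun q : R * 'rV[R]_n => q.2 0 i) (v.2 0 i).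
Proof.
apply/is_derive_epsP => e e0; exists 1 => // h _ /=.
by rewrite !mxE addrK -[h *: _]/(h * _) subrr normr0 mulr_ge0 // ltW.
Qed.

Lemma is_derive_tube_rho {R : realType} {n : nat} {gam g : R -> 'rV[R]_n}
    (a c t1 : R) (p v : R * 'rV[R]_n) :
  (forall s, is_derive s (1 : R) gam (g s)) ->
  is_derive p v (tube_rho gam a c t1) (tube_drho gam g a c t1 p v).
Proof.
move=> dgam.
have d1 := is_derive_fst p v.
have dE : is_derive p v (fun q : R * 'rV[R]_n => expR (a * (q.1 + 1))) (expR (a * (p.1 + 1)) * (a * v.1)).
  apply: is_derive_comp1.
  apply: (@is_deriveZ _ _ _ (fun q : R * 'rV[R]_n => q.1 + 1) a p v v.1).
  rewrite -[v.1]addr0.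
  by have := is_deriveD d1 (is_derive_cst (1 : R) p v); exact.
have dsum : is_derive p v (fun q : R * 'rV[R]_n => \sum_(i < n) (q.2 0 i - gam q.1 0 i) ^+ 2)
    (\sum_(i < n) 2 * (p.2 0 i - gam p.1 0 i) * (v.2 0 i - v.1 * g p.1 0 i)).
  have -> : (fun q : R * 'rV[R]_n => \sum_(i < n) (q.2 0 i - gam q.1 0 i) ^+ 2) =
    \sum_(i < n) (fun q : R * 'rV[R]_n => (q.2 0 i - gam q.1 0 i) ^+ 2).
    by apply/funext => q; rewrite fct_sumE.
  apply: is_derive_sum => i.
  have dd : is_derive p v (fun q : R * 'rV[R]_n => q.2 0 i - gam q.1 0 i) (v.2 0 i - v.1 * g p.1 0 i).
    apply: is_deriveB; first exact: is_derive_snd_coord.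
    rewrite mulrC; apply: (is_derive_comp1 (phi := fun s => gam s 0 i)).
    exact: is_derive_coord.
  by have := @is_deriveX _ _ (fun q : R * 'rV[R]_n => q.2 0 i - gam q.1 0 i) 2 p v _ dd; rewrite expr1.
have ds1 : is_derive p v (fun q : R * 'rV[R]_n => sqpos (q.1 - t1)) (2 * Num.max 0 (p.1 - t1) * v.1).
  apply: is_derive_comp1; last exact: is_derive_sqpos.
  rewrite -[v.1]subr0.
  by have := is_deriveB d1 (is_derive_cst t1 p v); exact.
have ds2 : is_derive p v (fun q : R * 'rV[R]_n => sqpos (- q.1)) (2 * Num.max 0 (- p.1) * - v.1).
  apply: is_derive_comp1; last exact: is_derive_sqpos.
have dall := is_deriveD (is_deriveD (is_deriveM dE dsum) (is_deriveZ c ds1)) ds2.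
apply: (is_derive_eq dall); rewrite /tube_drho -![_ *: _]/(_ * _) /=; ring.
Qed.

Lemma continuous_sum_ord {R : realType} {T : topologicalType} {n : nat}
    {f : 'I_n -> T -> R} :
  (forall i, continuous (f i)) -> continuous (fun p => \sum_(i < n) f i p).
Proof.
move=> cf; have -> : (fun p => \sum_(i < n) f i p) = \sum_(i < n) f i.
  by apply/funext => p; rewrite fct_sumE.
elim/big_ind : _ => // [|g h cg ch]; first exact: cst_continuous.
by move=> p; apply: continuousD; [exact: cg|exact: ch].
Qed.

Lemma continuous_add {R : realType} {T : topologicalType} {f g : T -> R} :
  continuous f -> continuous g -> continuous (fun p => f p + g p).
Proof. by move=> cf cg p; apply: continuousD; [exact: cf|exact: cg]. Qed.

Lemma continuous_opp {R : realType} {T : topologicalType} {f : T -> R} :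
  continuous f -> continuous (fun p => - f p).
Proof. by move=> cf p; apply: continuousN; exact: cf. Qed.

Lemma continuous_mul {R : realType} {T : topologicalType} {f g : T -> R} :
  continuous f -> continuous g -> continuous (fun p => f p * g p).
Proof. by move=> cf cg p; apply: continuousM; [exact: cf|exact: cg]. Qed.

Lemma continuous_compT {T U V : topologicalType} {f : T -> U} {g : U -> V} :
  continuous f -> continuous g -> continuous (fun p => g (f p)).
Proof. by move=> cf cg p; apply: continuous_comp; [exact: cf|exact: cg]. Qed.

Lemma fst_continuous {R : realType} {V : normedModType R} :
  continuous (fst : R * V -> R).
Proof. by move=> p; exact: cvg_fst. Qed.

Lemma coord_row_continuous {R : realType} {n : nat} {T : topologicalType}
    {f : T -> 'rV[R]_n} (i : 'I_n) :
  continuous f -> continuous (fun p => f p 0 i).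
Proof.
move=> cf p; apply: (@continuous_comp _ _ _ f (fun M : 'rV[R]_n => M 0 i)).
  exact: cf.
exact: coord_continuous.
Qed.

Lemma tube_dist_continuous {R : realType} {n : nat} {gam : R -> 'rV[R]_n}
    (i : 'I_n) : continuous gam ->
  continuous (fun p : R * 'rV[R]_n => p.2 0 i - gam p.1 0 i).
Proof.
move=> cgam; apply: continuous_add.
  apply: (@coord_row_continuous _ _ (R * 'rV[R]_n)%type snd i) => p; exact: cvg_snd.
apply: continuous_opp; apply: (@coord_row_continuous _ _ _ (fun p => gam p.1) i).
by apply: continuous_compT cgam; exact: fst_continuous.
Qed.

Lemma tube_exp_continuous {R : realType} {V : normedModType R} (a : R) :
  continuous (fun p : R * V => expR (a * (p.1 + 1))).
Proof.
apply: continuous_compT; last exact: continuous_expR.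
apply: continuous_mul; first exact: cst_continuous.
apply: continuous_add; [exact: fst_continuous|exact: cst_continuous].
Qed.

Lemma tube_rho_continuous {R : realType} {n : nat} {gam : R -> 'rV[R]_n}
    (a c t1 : R) : continuous gam -> continuous (tube_rho gam a c t1).
Proof.
move=> cgam; apply: continuous_add; first apply: continuous_add.
- apply: continuous_mul; first exact: tube_exp_continuous.
  by apply: continuous_sum_ord => i; apply: continuous_mul; exact: tube_dist_continuous.
- apply: continuous_mul; first exact: cst_continuous.
  apply: continuous_compT sqpos_continuous.
  by apply: continuous_add; [exact: fst_continuous|exact: cst_continuous].
apply: continuous_compT sqpos_continuous.
by apply: continuous_opp; exact: fst_continuous.
Qed.

Lemma tube_drho_continuous {R : realType} {n : nat} {gam g : R -> 'rV[R]_n}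
    (a c t1 : R) (v : R * 'rV[R]_n) :
  continuous gam -> continuous g ->
  continuous (fun p => tube_drho gam g a c t1 p v).
Proof.
move=> cgam cg.
have cmax (f : R * 'rV[R]_n -> R) : continuous f ->
    continuous (fun p => 2 * Num.max 0 (f p) * v.1).
  move=> cf; apply: continuous_mul; last exact: cst_continuous.
  apply: continuous_mul; first exact: cst_continuous.
  exact: continuous_compT max0_continuous.
apply: continuous_add; first apply: continuous_add.
- apply: continuous_mul; first exact: tube_exp_continuous.
  apply: continuous_add.
    apply: continuous_mul; first exact: cst_continuous.
    by apply: continuous_sum_ord => i; apply: continuous_mul; exact: tube_dist_continuous.
  apply: continuous_sum_ord => i; apply: continuous_mul.
    by apply: continuous_mul; [exact: cst_continuous|exact: tube_dist_continuous].
  apply: continuous_add; first exact: cst_continuous.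
  apply: continuous_opp; apply: continuous_mul; first exact: cst_continuous.
  apply: (@coord_row_continuous _ _ _ (fun p => g p.1) i).
  by apply: continuous_compT cg; exact: fst_continuous.
- apply: continuous_mul; first exact: cst_continuous.
  by apply: cmax; apply: continuous_add; [exact: fst_continuous|exact: cst_continuous].
by apply: continuous_opp; apply: cmax; apply: continuous_opp; exact: fst_continuous.
Qed.

Lemma sqpos_le0 {R : realType} {u : R} : u <= 0 -> sqpos u = 0.
Proof. by move=> u0; rewrite /sqpos max_l // expr0n. Qed.

Lemma sqpos_gt0 {R : realType} {u : R} : 0 < u -> 0 < sqpos u.
Proof. by move=> u0; rewrite /sqpos max_r ?exprn_gt0 // ltW. Qed.

Lemma sqpos_lt_sqr {R : realType} {u e : R} : 0 < e -> sqpos u < e ^+ 2 -> u < e.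
Proof.
move=> e0; rewrite /sqpos; have [u0|u0] := leP 0 u; first by rewrite ltr_sqr ?nnegrE // ltW.
by move=> _; lra.
Qed.

(** The ambient norm is the maximum norm, which is not smooth; tubes use the Euclidean square and
    return to the norm through this bound. *)
Lemma sqr_norm_le_sum {R : realType} {n : nat} (d : 'rV[R]_n) :
  `|d| ^+ 2 <= \sum_(i < n) d 0 i ^+ 2.
Proof.
have S0 : 0 <= \sum_(i < n) d 0 i ^+ 2 by apply: sumr_ge0 => i _; exact: sqr_ge0.
rewrite -[leRHS]sqr_sqrtr // ler_sqr ?nnegrE ?sqrtr_ge0 //.
apply: norm_row_le => [|i]; first exact: sqrtr_ge0.
rewrite -sqrtr_sqr ler_wsqrtr // (bigD1 i) //= lerDl.
by apply: sumr_ge0 => j _; exact: sqr_ge0.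
Qed.

(** All three terms of [tube_rho] are nonnegative, so each is below [e ^+ 2]: the [sqpos] terms
    confine the time, the first one the distance. *)
Lemma tube_rho_lt {R : realType} {n : nat} {gam : R -> 'rV[R]_n} {a c t1 e : R}
    {p : R * 'rV[R]_n} :
  0 <= a -> 1 <= c -> 0 < e <= 1 -> tube_rho gam a c t1 p < e ^+ 2 ->
  [/\ -1 < p.1, p.1 < t1 + e & `|p.2 - gam p.1| < e].
Proof.
move=> a0 c1 /andP[e0 e1]; rewrite /tube_rho => re.
set S := \sum_(i < n) _ in re; set E := expR _ in re.
have S0 : 0 <= S by apply: sumr_ge0 => i _; exact: sqr_ge0.
have E0 : 0 < E by exact: expR_gt0.
have ES : 0 <= E * S by rewrite mulr_ge0 // ltW.
have s1 := sqpos_ge0 (p.1 - t1); have s2 := sqpos_ge0 (- p.1).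
have cs : 0 <= c * sqpos (p.1 - t1) by rewrite mulr_ge0 //; lra.
have p1 : -1 < p.1.
  have : sqpos (- p.1) < e ^+ 2 by lra.
  by move=> /(sqpos_lt_sqr e0); lra.
have p2 : p.1 < t1 + e.
  have : sqpos (p.1 - t1) < e ^+ 2.
    by apply: le_lt_trans (_ : c * sqpos (p.1 - t1) < _); [rewrite ler_peMl|lra].
  by move=> /(sqpos_lt_sqr e0); lra.
split=> //.
(* The shift in [a * (p.1 + 1)] makes the exponent nonnegative for all times above -1. *)
have E1 : 1 <= E.
  apply: le_trans (expR_ge1Dx _); rewrite lerDl mulr_ge0 //; lra.
rewrite -ltr_sqr ?nnegrE ?(ltW e0) //.
apply: le_lt_trans (sqr_norm_le_sum _) _.
have -> : \sum_(i < n) (p.2 - gam p.1) 0 i ^+ 2 = S.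
  by apply: eq_bigr => i _; rewrite !mxE.
by apply: le_lt_trans (_ : E * S < _); [rewrite ler_peMl|lra].
Qed.

(** A uniform margin from local ones, by compactness of [[0, t1]]. The slack between [s] and [s']
    covers the overshoot of the tube past [t1]. *)
Lemma tube_clearance {R : realType} {n : nat} {Xo : set 'rV[R]_n}
    {gam : R -> 'rV[R]_n} {t1 : R} :
  closed Xo -> continuous gam -> 0 <= t1 ->
  (forall s, 0 <= s <= t1 -> ~ Xo (gam s)) ->
  exists2 e : R, 0 < e <= 1 & forall s s' y, 0 <= s <= t1 ->
    `|s' - s| <= e -> `|y - gam s'| <= e -> ~ Xo y.
Proof.
move=> clXo cgam t10 avoid.
pose P b := b <= t1 -> exists2 e : R, 0 < e <= 1 & forall s s' y, 0 <= s <= b ->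
    `|s' - s| <= e -> `|y - gam s'| <= e -> ~ Xo y.
have loc s : 0 <= s <= t1 -> exists2 e : R, 0 < e <= 1 & forall s0 s' y,
    `|s0 - s| < e -> `|s' - s0| <= e -> `|y - gam s'| <= e -> ~ Xo y.
  move=> /avoid nXo.
  have : nbhs (gam s) (~` Xo).
    by apply: open_nbhs_nbhs; split => //; exact: closed_openC.
  move=> /nbhs_ballP[r /= r0 Hr].
  have /cvgrPdist_lt/(_ (r / 2)) := cgam s.
  move=> /(_ ltac:(by rewrite divr_gt0))/nbhs_ballP[d /= d0 Hd].
  (* Two time gaps of [d / 2] add up to [d]; the space gaps [r / 2] and [r / 4] stay below [r]. *)
  exists (Num.min 1 (Num.min (d / 2) (r / 2 / 2))).
    by rewrite !lt_min ltr01 !divr_gt0 //= ge_min lexx.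
  move=> s0 s' y; rewrite !lt_min !le_min => /and3P[_ s0d _] /and3P[_ s'd _] /and3P[_ _ yr].
  apply: Hr; rewrite -ball_normE /=.
  have : `|gam s - gam s'| < r / 2.
    apply: Hd; rewrite -ball_normE /= distrC.
    by have := ler_distD s0 s' s; lra.
  have := ler_distD (gam s') (gam s) y; rewrite [`|gam s' - y|]distrC; lra.
have step : P t1; last by exact: step.
apply: (@interval_induction R 0 t1 P) => // [_|s st].
  have [|e e01 He] := loc 0; first by rewrite lexx.
  exists e => // s s' y s0; apply: He.
  have -> : s = 0 by lra.
  by rewrite subrr normr0; lra.
have [e e01 He] := loc s st; have /andP[e0 _] := e01; exists e => //.
move=> c c' /andP[c0 cs] /andP[sc' c't] sec c'e Pc _.
have /Pc[e' e'01 He'] : c <= t1 by lra.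
exists (Num.min e e'); first by case: (leP e e').
move=> s0 s' y /andP[s00 s0c']; rewrite !le_min => /andP[h1 h2] /andP[h3 h4].
have [s0c|cs0] := leP s0 c; first by apply: (He' s0 s') => //; apply/andP.
by apply: (He s0 s') => //; rewrite ltr_norml; apply/andP; split; lra.
Qed.

Lemma tube_drho_xdir {R : realType} {n : nat} (gam g : R -> 'rV[R]_n)
    (a c t1 : R) (p : R * 'rV[R]_n) (j : 'I_n) :
  tube_drho gam g a c t1 p (xdir R j) =
  expR (a * (p.1 + 1)) * (2 * (p.2 0 j - gam p.1 0 j)).
Proof.
rewrite /tube_drho /= !mulr0 !mul0r addr0 subr0 add0r; congr (_ * _).
rewrite (bigD1 j) //= mxE !eqxx mul0r subr0 mulr1 big1 ?addr0 // => i ij.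
by rewrite mxE eqxx (negbTE ij) mul0r subr0 mulr0.
Qed.

(** A Gronwall estimate. Along the flow the squared distance [S] decreases at rate at most
    [2 * n * (L * S + C * m)], the factor [n] coming from a sum over coordinates of maximum norm
    bounds. The exponential weight compensates the part in [S], the term with [c] the part in
    [m]. *)
Lemma tube_drho_flow {R : realType} {n : nat} {F : 'rV[R]_n -> 'rV[R]_n}
    {gam g : R -> 'rV[R]_n} {L C c t1 : R} {p : R * 'rV[R]_n} :
  0 <= L -> 0 <= C -> 0 <= p.1 <= t1 + 1 -> `|p.2 - gam p.1| <= 1 ->
  `|F p.2 - F (gam p.1)| <= L * `|p.2 - gam p.1| ->
  `|F (gam p.1) - g p.1| <= C * Num.max 0 (p.1 - t1) ->
  expR (2 * n%:R * L * (t1 + 2)) * (n%:R * C) <= c ->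
  0 <= tube_drho gam g (2 * n%:R * L) c t1 p (tdir R n) +
       \sum_(i < n) tube_drho gam g (2 * n%:R * L) c t1 p (xdir R i) * F p.2 0 i.
Proof.
move=> L0 C0 /andP[p0 p1]; set d := p.2 - gam p.1; set m := Num.max 0 _.
set a := 2 * n%:R * L => d1 FL FC cE.
have a0 : 0 <= a by rewrite !mulr_ge0.
have m0 : 0 <= m by rewrite le_max lexx.
set E := expR (a * (p.1 + 1)).
set S := \sum_(i < n) (p.2 0 i - gam p.1 0 i) ^+ 2.
have E0 : 0 < E by exact: expR_gt0.
have EE : E <= expR (a * (t1 + 2)) by rewrite ler_expR ler_wpM2l //; lra.
have dS : `|d| ^+ 2 <= S.
  apply: le_trans (sqr_norm_le_sum _) _.
  by apply: ler_sum => i _; rewrite !mxE.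
under eq_bigr => i _ do rewrite tube_drho_xdir -/E.
rewrite /tube_drho /= -/E -/S -/m max_l ?oppr_le0 // mulr0 mul0r subr0 !mulr1.
have -> : E * (a * S + \sum_(i < n) 2 * (p.2 0 i - gam p.1 0 i) *
      ((0 : 'rV[R]_n) 0 i - 1 * g p.1 0 i)) + c * (2 * m) +
    \sum_(i < n) E * (2 * (p.2 0 i - gam p.1 0 i)) * F p.2 0 i =
  E * (a * S + 2 * \sum_(i < n) d 0 i * (F p.2 0 i - g p.1 0 i)) + 2 * (c * m).
  rewrite mulr_sumr !mulrDr -!addrA; congr (_ + _).
  rewrite [c * _ + _]addrC addrA; congr (_ + _); last by ring.
  rewrite !mulr_sumr -big_split /=; apply: eq_bigr => i _; rewrite !mxE; ring.
set T := \sum_(i < n) _ * _.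
have TB : - (n%:R * L * S + n%:R * C * m) <= T.
  apply: (@le_trans _ _ (- \sum_(i < n) `|d| * (L * `|d| + C * m))); last first.
    rewrite -sumrN; apply: ler_sum => i _.
    rewrite lerNl -mulNr; apply: le_trans (ler_norm _) _; rewrite normrM normrN.
    apply: ler_pM => //; first exact: coord_le_norm.
    have -> : F p.2 0 i - g p.1 0 i = (F p.2 - F (gam p.1)) 0 i + (F (gam p.1) - g p.1) 0 i.
      by rewrite !mxE; ring.
    apply: le_trans (ler_normD _ _) (lerD _ _).
      exact: le_trans (coord_le_norm _ _) FL.
    exact: le_trans (coord_le_norm _ _) FC.
  have -> : \sum_(i < n) `|d| * (L * `|d| + C * m) = n%:R * (`|d| * (L * `|d| + C * m)).
    by rewrite sumr_const card_ord mulr_natl.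
  have -> : n%:R * L * S + n%:R * C * m = n%:R * (L * S + C * m) by ring.
  rewrite lerN2 ler_wpM2l //.
  have Cm : 0 <= C * m by rewrite mulr_ge0.
  have H1 : `|d| * (C * m) <= C * m by rewrite ler_piMl.
  have H2 : L * `|d| ^+ 2 <= L * S by rewrite ler_wpM2l.
  rewrite mulrDr; apply: lerD => //.
  by rewrite mulrCA -expr2.
have : E * (a * S + 2 * T) >= E * (- (2 * (n%:R * C * m))).
  rewrite ler_wpM2l ?(ltW E0) // /a; lra.
have : E * (n%:R * C * m) <= c * m.
  rewrite mulrA ler_wpM2r //; apply: le_trans cE.
  by rewrite ler_wpM2r // mulr_ge0.
lra.
Qed.

(** * Barriers positive at a prescribed point *)

(** Made to be stable under weighted sums: the common bound 1 gives convergence of values and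
    partial derivatives, nonnegativity prevents cancellation, and the flow inequality is asked at
    all nonnegative times. *)
Definition good_barrier {R : realType} {n : nat} (F : 'rV[R]_n -> 'rV[R]_n)
    (Xo : set 'rV[R]_n) (Psi : R * 'rV[R]_n -> R) : Prop :=
  [/\ forall p, 0 <= Psi p <= 1,
      continuous Psi,
      forall o, continuous ('D_(coord_dir R n o) Psi) /\
        forall p, derivable Psi p (coord_dir R n o) /\
                  `|'D_(coord_dir R n o) Psi p| <= 1,
      forall t x, 0 <= t -> Xo x -> Psi (t, x) = 0 &
      forall p, 0 <= p.1 -> lie_der Psi F p <= 0].

Definition tube_barrier {R : realType} {n : nat} (gam : R -> 'rV[R]_n)
    (a c t1 k e : R) (p : R * 'rV[R]_n) : R :=
  k * sqpos (e ^+ 2 - tube_rho gam a c t1 p).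

Lemma is_derive_tube_barrier {R : realType} {n : nat} {gam g : R -> 'rV[R]_n}
    (a c t1 k e : R) (p v : R * 'rV[R]_n) :
  (forall s, is_derive s (1 : R) gam (g s)) ->
  is_derive p v (tube_barrier gam a c t1 k e)
    (- (k * (2 * Num.max 0 (e ^+ 2 - tube_rho gam a c t1 p) *
             tube_drho gam g a c t1 p v))).
Proof.
move=> /(is_derive_tube_rho a c t1 p v) drho.
have d1 : is_derive p v (fun q => e ^+ 2 - tube_rho gam a c t1 q)
    (0 - tube_drho gam g a c t1 p v).
  by have := is_deriveB (is_derive_cst (e ^+ 2) p v) drho; exact.
have dall := is_deriveZ k (is_derive_comp1 d1 (is_derive_sqpos _)).
by apply: (is_derive_eq dall); rewrite -[_ *: _]/(_ * _); ring.
Qed.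

Lemma exists_good_barrier {R : realType} {n : nat} {F : 'rV[R]_n -> 'rV[R]_n}
    {Xo Xu : set 'rV[R]_n} {t1 : R} {x1 : 'rV[R]_n} :
  C1_map F -> backward_complete F -> closed Xo -> safe F Xo Xu ->
  0 <= t1 -> Xu x1 ->
  exists2 Psi, good_barrier F Xo Psi & 0 < Psi (t1, x1).
Proof.
move=> C1F bcF clXo safeF t10 Xux1.
have cF := C1_map_continuous C1F.
have [gam [g [cg dgam gF gext avoid]]] := backward_curve cF bcF safeF t10 Xux1.
have gamt1 : gam t1 = x1.
  by have [_ ->] := gext t1 (lexx _); rewrite subrr scale0r add0r.
have cgam : continuous gam.
  move=> s; apply/differentiable_continuous/derivable1_diffP.
  by have [] := dgam s.
have [e e01 clear] := tube_clearance clXo cgam t10 avoid.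
have /andP[e0 e1] := e01.
have [r0 r00 Hr0] := @continuous_compact_bounded R _ _ gam _
  (@segment_compact R (-1) (t1 + 1)) (in1W cgam).
have {}Hr0 s : -1 <= s <= t1 + 1 -> `|gam s| <= r0.
  by move=> st; apply: Hr0; rewrite /= in_itv.
have [L L0 HL] := C1_map_lipschitz (r0 + 1) C1F.
(* Past [t1], [gam] is at distance [(s - t1) * |F x1|] from [x1], so [C * (s - t1)] bounds the
   defect between [F (gam s)] and [F x1]. *)
pose C := L * `|F x1|; have C0 : 0 <= C by rewrite mulr_ge0.
pose a := 2 * n%:R * L; have a0 : 0 <= a by rewrite !mulr_ge0.
(* The first summand is what [tube_drho_flow] requires; adding 1 gives the [1 <= c] of
   [tube_rho_lt]. *)
pose c := expR (a * (t1 + 2)) * (n%:R * C) + 1.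
have c1 : 1 <= c by rewrite lerDr mulr_ge0 ?expR_ge0 // mulr_ge0.
pose rho := tube_rho gam a c t1.
pose H o p := 2 * Num.max 0 (e ^+ 2 - rho p) * tube_drho gam g a c t1 p (coord_dir R n o).
have crho : continuous rho by exact: tube_rho_continuous.
have cpos : continuous (fun p => e ^+ 2 - rho p).
  by apply: continuous_add; [exact: cst_continuous|exact: continuous_opp].
have cH o : continuous (H o).
  apply: continuous_mul; last exact: tube_drho_continuous.
  apply: continuous_mul; first exact: cst_continuous.
  exact: continuous_compT cpos max0_continuous.
(* Compact and large enough to contain the tube; outside the tube every [H o] vanishes, so bounds on
   [K] are global. *)
pose K := `[-1, t1 + 1]%classic `*` [set z : 'rV[R]_n | `|z| <= r0 + 1].
have cK : compact K.
  by apply: compact_setX; [exact: segment_compact|exact: compact_closed_ball].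
have inK p : rho p < e ^+ 2 -> [/\ -1 < p.1, p.1 < t1 + e & `|p.2 - gam p.1| < e].
  exact: tube_rho_lt.
have normp p : rho p < e ^+ 2 -> `|p.2| <= r0 + 1.
  move=> /inK[h1 h2 h3]; have := Hr0 p.1 ltac:(apply/andP; split; lra).
  by have := ler_normD (p.2 - gam p.1) (gam p.1); rewrite subrK; lra.
have Hout o p : e ^+ 2 <= rho p -> H o p = 0.
  by move=> er; rewrite /H max_l ?subr_le0 // mulr0 mul0r.
have /choice[M HM] : forall o, exists M : R, 0 <= M /\ forall p, `|H o p| <= M.
  move=> o; have [M M0 HM] := @continuous_compact_bounded R _ _ (H o) _ cK (in1W (cH o)).
  exists M; split => // p; have [er|re] := leP (e ^+ 2) (rho p).
    by rewrite Hout // normr0.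
  apply: HM; split; last exact: normp.
  by have [? ? _] := inK p re; rewrite /= in_itv /=; apply/andP; split; lra.
have M0 o : 0 <= M o by have [] := HM o.
(* Normalises all partial derivatives to at most 1; the summand 1 ensures [k <= 1], which bounds the
   values. *)
pose k := (1 + \sum_o M o)^-1.
have s0 : 0 <= \sum_o M o by apply: sumr_ge0.
have k0 : 0 < k by rewrite invr_gt0; lra.
have k1 : k <= 1 by rewrite invf_le1; lra.
have kM o p : `|k * H o p| <= 1.
  rewrite normrM gtr0_norm // /k mulrC ler_pdivrMr ?mul1r; last lra.
  apply: le_trans (proj2 (HM o) p) _; rewrite (bigD1 o) //= addrCA lerDl.
  by rewrite addr_ge0 // sumr_ge0.
pose Psi := tube_barrier gam a c t1 k e.
have dPsi p o : is_derive p (coord_dir R n o) Psi (- (k * H o p)).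
  exact: is_derive_tube_barrier.
have DPsi o : 'D_(coord_dir R n o) Psi = (fun p => - (k * H o p)).
  by apply/funext => p; have [] := dPsi p o.
have rho0 p : 0 <= rho p.
  rewrite /rho /tube_rho !addr_ge0 ?sqpos_ge0 // mulr_ge0 ?expR_ge0 ?sqpos_ge0 //.
    by apply: sumr_ge0 => i _; exact: sqr_ge0.
  lra.
exists Psi; last first.
  rewrite /Psi /tube_barrier mulr_gt0 // sqpos_gt0 //.
  have -> : tube_rho gam a c t1 (t1, x1) = 0.
    rewrite /tube_rho /= gamt1 subrr !sqpos_le0 ?oppr_le0 //.
    rewrite big1 ?mulr0 ?addr0 // => i _; by rewrite subrr expr0n.
  by rewrite subr0 exprn_gt0.
split.
- move=> p; rewrite /Psi /tube_barrier mulr_ge0 ?sqpos_ge0 ?(ltW k0) //=.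
  apply: mulr_ile1; rewrite ?sqpos_ge0 ?(ltW k0) // /sqpos.
  apply: exprn_ile1; first by rewrite le_max lexx.
  rewrite ge_max ler01 /=; have := rho0 p; rewrite /rho.
  have : e ^+ 2 <= 1 by apply: exprn_ile1 => //; exact: ltW.
  lra.
- apply: continuous_mul; first exact: cst_continuous.
  exact: continuous_compT cpos sqpos_continuous.
- move=> o; rewrite DPsi; split.
    apply: continuous_opp; apply: continuous_mul => //; exact: cst_continuous.
  by move=> p; have [dp ->] := dPsi p o; split => //; rewrite normrN.
- move=> t x t0 Xox; rewrite /Psi /tube_barrier.
  have [er|re] := leP (e ^+ 2) (rho (t, x)).
    by rewrite sqpos_le0 ?mulr0 ?subr_le0.
  have [/= h1 h2 h3] := inK _ re.
  (* For times past [t1] the clearance is taken from the reference time [t1]. *)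
  have [tt1|tt1] := leP t t1.
    case: (clear t t x) => //; first by rewrite t0.
      by rewrite subrr normr0 ltW.
    exact: ltW.
  case: (clear t1 t x) => //; first by rewrite t10 lexx.
    by rewrite gtr0_norm ?subr_gt0 //; lra.
  exact: ltW.
- move=> p p0; rewrite /lie_der.
  have -> : 'D_(tdir R n) Psi p = - (k * H None p) by have [] := dPsi p None.
  have -> : \sum_(i < n) 'D_(xdir R i) Psi p * F p.2 0 i =
      \sum_(i < n) - (k * H (Some i) p) * F p.2 0 i.
    by apply: eq_bigr => i _; have [_ <-] := dPsi p (Some i).
  have [er|re] := leP (e ^+ 2) (rho p).
    rewrite Hout // mulr0 oppr0 big1 ?addr0 // => i _.
    by rewrite Hout // mulr0 oppr0 mul0r.
  have [h1 h2 h3] := inK _ re.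
  have -> : - (k * H None p) + \sum_(i < n) - (k * H (Some i) p) * F p.2 0 i =
    - (k * (2 * Num.max 0 (e ^+ 2 - rho p)) * (tube_drho gam g a c t1 p (tdir R n) +
       \sum_(i < n) tube_drho gam g a c t1 p (xdir R i) * F p.2 0 i)).
    rewrite mulrDr opprD mulr_sumr -sumrN /H /=; congr (_ + _); first by ring.
    by apply: eq_bigr => i _; ring.
  rewrite oppr_le0 mulr_ge0 //.
    by rewrite mulr_ge0 ?(ltW k0) // mulr_ge0 // le_max lexx.
  have gamp : `|gam p.1| <= r0 by apply: Hr0; apply/andP; split; lra.
  have gamp1 : `|gam p.1| <= r0 + 1 by lra.
  apply: (@tube_drho_flow R n F gam g L C c t1 p) => //.
  + by apply/andP; split; lra.
  + lra.
  + by apply: HL => //; exact: normp.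
  + have [pt|tp] := leP p.1 t1.
      by rewrite gF // subrr normr0 mulr_ge0 // le_max lexx.
    have [-> gamE] := gext _ (ltW tp).
    rewrite max_r ?subr_ge0 ?(ltW tp) //.
    apply: le_trans (HL _ _ gamp1 _) _.
      have := Hr0 t1 ltac:(apply/andP; split; lra); rewrite gamt1; lra.
    rewrite gamE addrK normrZ gtr0_norm ?subr_gt0 // /C.
    by rewrite [(_ - _) * _]mulrC mulrA.
  + by rewrite /c lerDl.
Qed.

(** * Dyadic sums *)

(** The weights add up to 1. [limn] has a default value on divergent series, hence the boundedness
    assumptions below. *)
Definition dyadic_sum {R : realType} (a : nat -> R) : R :=
  limn (series (fun k => 2^-1 ^+ k.+1 * a k)).

Definition bounded_seq {R : realType} (a : nat -> R) : Prop :=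
  exists C : R, forall k, `|a k| <= C.

Lemma dyadic_series_cvg {R : realType} {a : nat -> R} :
  bounded_seq a -> cvgn (series (fun k => 2^-1 ^+ k.+1 * a k)).
Proof.
move=> [C aC]; apply: normed_cvg.
have C0 : 0 <= C by apply: le_trans (aC 0%N).
have w0 k : 0 <= (2^-1 : R) ^+ k by rewrite exprn_ge0.
apply: (@series_le_cvg _ _ (geometric (C / 2) 2^-1)) => [k|k|k|].
- by rewrite normr_ge0.
- by rewrite /= mulr_ge0 // divr_ge0.
- rewrite /= normrM ger0_norm //.
  have -> : C / 2 * 2^-1 ^+ k = 2^-1 ^+ k.+1 * C by rewrite exprS; ring.
  by rewrite ler_wpM2l.
- by apply: is_cvg_geometric_series; rewrite ger0_norm // invf_lt1 // ltr1n.
Qed.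

Lemma dyadic_sumD {R : realType} {a b : nat -> R} :
  bounded_seq a -> bounded_seq b ->
  dyadic_sum (fun k => a k + b k) = dyadic_sum a + dyadic_sum b.
Proof.
move=> /dyadic_series_cvg ca /dyadic_series_cvg cb.
rewrite /dyadic_sum -lim_seriesD //; congr (limn (series _)).
by apply/funext => k; rewrite /= mulrDr.
Qed.

Lemma dyadic_sumZ {R : realType} {a : nat -> R} (c : R) :
  bounded_seq a -> dyadic_sum (fun k => c * a k) = c * dyadic_sum a.
Proof.
move=> /dyadic_series_cvg ca.
rewrite /dyadic_sum -[c * _]/(c *: _) -lim_seriesZ //; congr (limn (series _)).
by apply/funext => k; rewrite /= mulrCA.
Qed.

Lemma bounded_seqD {R : realType} {a b : nat -> R} :
  bounded_seq a -> bounded_seq b -> bounded_seq (fun k => a k + b k).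
Proof.
move=> [C aC] [C' bC']; exists (C + C') => k.
exact: le_trans (ler_normD _ _) (lerD (aC k) (bC' k)).
Qed.

Lemma bounded_seqZ {R : realType} {a : nat -> R} (c : R) :
  bounded_seq a -> bounded_seq (fun k => c * a k).
Proof.
by move=> [C aC]; exists (`|c| * C) => k; rewrite normrM ler_wpM2l.
Qed.

(** Lets a Lie derivative, a finite combination of partial derivatives, pass through the series.
    Boundedness is carried along because additivity needs it at each step of the induction. *)
Lemma dyadic_sum_sum {R : realType} {I : Type} (s : seq I) {a : I -> nat -> R}
    (c : I -> R) : (forall i, bounded_seq (a i)) ->
  bounded_seq (fun k => \sum_(i <- s) c i * a i k) /\
  dyadic_sum (fun k => \sum_(i <- s) c i * a i k) =
    \sum_(i <- s) c i * dyadic_sum (a i).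
Proof.
move=> ba; elim: s => [|i s [bs IH]].
  rewrite big_nil.
  have -> : (fun k => \sum_(i <- [::]) c i * a i k) = (fun k => 0 * (0 : R)).
    by apply/funext => k; rewrite big_nil mul0r.
  have b0 : bounded_seq (fun=> 0 : R) by exists 0 => k; rewrite normr0.
  by split; [exact: bounded_seqZ|rewrite dyadic_sumZ // mul0r].
have -> : (fun k => \sum_(i <- i :: s) c i * a i k) =
    (fun k => c i * a i k + \sum_(i <- s) c i * a i k).
  by apply/funext => k; rewrite big_cons.
have bi := bounded_seqZ (c i) (ba i).
split; first exact: bounded_seqD.
by rewrite dyadic_sumD // dyadic_sumZ // IH big_cons.
Qed.

Lemma dyadic_sum_ge_term {R : realType} {a : nat -> R} (k : nat) :
  bounded_seq a -> (forall k, 0 <= a k) -> 2^-1 ^+ k.+1 * a k <= dyadic_sum a.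
Proof.
move=> /dyadic_series_cvg ca a0.
have t0 j : 0 <= (2^-1 : R) ^+ j.+1 * a j by rewrite mulr_ge0 // exprn_ge0.
apply: le_trans (nondecreasing_cvgn_le _ ca k.+1).
  by rewrite /series /= big_nat_recr //= lerDr sumr_ge0.
by apply: nondecreasing_series => j _ _.
Qed.

Lemma dyadic_sum_ge0 {R : realType} {a : nat -> R} :
  bounded_seq a -> (forall k, 0 <= a k) -> 0 <= dyadic_sum a.
Proof.
move=> ba a0; apply: le_trans (dyadic_sum_ge_term 0 ba a0).
by rewrite mulr_ge0 // exprn_ge0.
Qed.

(* The error C / 2^N comes from the tail, where only the crude bound C is used. *)
Lemma dyadic_sum_le {R : realType} {a : nat -> R} {C eta : R} (N : nat) :
  0 <= eta -> (forall k, `|a k| <= C) ->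
  (forall k, (k < N)%N -> `|a k| <= eta) ->
  `|dyadic_sum a| <= eta + C * 2^-1 ^+ N.
Proof.
move=> eta0 aC aeta.
have C0 : 0 <= C by apply: le_trans (aC 0%N).
pose w k := (2^-1 : R) ^+ k; have w0 k : 0 <= w k by rewrite exprn_ge0.
have wS k : w k.+1 = w k - w k.+1 by rewrite /w exprS; lra.
pose u := series (fun k => w k.+1 * a k).
(* [1 - w M] is the sum of the first [M] weights, and [w N - w M] the sum of those with index from
   [N] to [M - 1]. *)
have uM M : `|u M| <= eta * (1 - w M) + (if (M <= N)%N then 0 else C * (w N - w M)).
  elim: M => [|M IH].
    by rewrite /u /series /= big_nil normr0 /w expr0 subrr mulr0 addr0.
  rewrite /u /series /= big_nat_recr //=.
  apply: le_trans (ler_normD _ _) _; rewrite normrM ger0_norm //.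
  move: IH; rewrite /u /series /= => IH.
  have wM : 0 <= eta * w M.+1 by rewrite mulr_ge0.
  have wE := wS M.
  case: (ltnP M N) IH => [MN|NM] IH.
    have H : w M.+1 * `|a M| <= w M.+1 * eta by rewrite ler_wpM2l // aeta.
    by rewrite (ltnW MN) in IH; move: wE H IH wM; nra.
  have H : w M.+1 * `|a M| <= w M.+1 * C by rewrite ler_wpM2l.
  have IH' : `|\sum_(0 <= k < M) w k.+1 * a k| <= eta * (1 - w M) + C * (w N - w M).
    case: ifP IH => // MN; have -> : M = N by apply/eqP; rewrite eqn_leq MN.
    by rewrite subrr mulr0.
  by move: wE H IH' wM; nra.
have {}uM M : `|u M| <= eta + C * w N.
  apply: le_trans (uM M) _.
  have h1 : 0 <= eta * w M by rewrite mulr_ge0.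
  have h2 : 0 <= C * w M by rewrite mulr_ge0.
  have h3 : 0 <= C * w N by rewrite mulr_ge0.
  by case: ifP => _; lra.
have ca : bounded_seq a by exists C.
apply/ler_addgt0Pr => d d0.
have /cvgrPdist_lt/(_ d d0)[M _ HM] : u @ \oo --> dyadic_sum a by exact: dyadic_series_cvg.
have := HM M (leqnn _); have := uM M; rewrite /=.
have := ler_normD (dyadic_sum a - u M) (u M); rewrite subrK /w; lra.
Qed.

Lemma dyadic_sumB {R : realType} {a b : nat -> R} :
  bounded_seq a -> bounded_seq b ->
  dyadic_sum (fun k => a k - b k) = dyadic_sum a - dyadic_sum b.
Proof.
move=> ba bb; rewrite -[- dyadic_sum b]mulN1r -dyadic_sumZ // -dyadic_sumD //.
  by congr dyadic_sum; apply/funext => k; rewrite mulN1r.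
exact: bounded_seqZ.
Qed.

Lemma exists_dyadic_lt {R : realType} {e : R} : 0 < e ->
  exists N, (2^-1 : R) ^+ N < e.
Proof.
move=> e0; have h1 : `|2^-1 : R| < 1 by rewrite ger0_norm // invf_lt1 // ltr1n.
have /cvgrPdist_lt/(_ e e0)[N _ HN] := cvg_expr h1.
exists N; have := HN N (leqnn _); rewrite /= sub0r normrN.
by apply: le_lt_trans; exact: ler_norm.
Qed.

Lemma dyadic_sum_continuous {R : realType} {T : topologicalType}
    {f : nat -> T -> R} {C : R} :
  (forall k, continuous (f k)) -> (forall k p, `|f k p| <= C) ->
  continuous (fun p => dyadic_sum (fun k => f k p)).
Proof.
move=> cf fC p; apply: (iffRL (@cvgrPdist_le _ _ _ (nbhs p) _ _ _)) => e e0.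
have C0 : 0 <= C by apply: le_trans (fC 0%N p).
(* Differences of terms are bounded by [C + C]; the 1 guards against [C = 0]. *)
have [N HN] := @exists_dyadic_lt R (e / 2 / (C + C + 1)) ltac:(rewrite !divr_gt0 //; lra).
have bf q : bounded_seq (fun k => f k q) by exists C.
have : \forall q \near p, forall i : 'I_N, `|f i p - f i q| <= e / 2.
  apply: (@filter_forall _ _ (fun (i : 'I_N) q => `|f i p - f i q| <= e / 2) (nbhs p)) => i.
  have /cvgrPdist_le := cf i p; apply; lra.
apply: filterS => q Hq; rewrite -dyadic_sumB //.
have := @dyadic_sum_le R (fun k => f k p - f k q) (C + C) (e / 2) N.
move=> H; apply: le_trans (H _ _ _) _; first by lra.
- by move=> k; apply: le_trans (ler_normB _ _) (lerD _ _).
- by move=> k kN; exact: (Hq (Ordinal kN)).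
move: HN; rewrite ltr_pdivlMr; last lra.
have w0 : 0 <= (2^-1 : R) ^+ N by rewrite exprn_ge0.
lra.
Qed.

(** Bounded derivatives make all terms Lipschitz with constant [C] along [v], so each remainder is
    at most [2 * C * |h|]. The tail is then small relative to [|h|] for an [N] independent of [h],
    and finitely many terms are left. *)
Lemma is_derive_dyadic_sum {R : realType} {V : normedModType R}
    {f : nat -> V -> R} {C : R} {v : V} (p : V) :
  (forall k q, `|f k q| <= C) ->
  (forall k q, derivable (f k) q v /\ `|'D_v (f k) q| <= C) ->
  is_derive p v (fun q => dyadic_sum (fun k => f k q))
    (dyadic_sum (fun k => 'D_v (f k) p)).
Proof.
move=> fC dfC; apply/is_derive_epsP => e e0.
have C0 : 0 <= C by apply: le_trans (fC 0%N p).
have [N HN] := @exists_dyadic_lt R (e / 2 / (C + C + 1)) ltac:(rewrite !divr_gt0 //; lra).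
have bf q : bounded_seq (fun k => f k q) by exists C.
have bD : bounded_seq (fun k => 'D_v (f k) p) by exists C => k; have [] := dfC k p.
have : \forall h \near (0 : R), forall i : 'I_N,
    `|f i (h *: v + p) - f i p - h * 'D_v (f i) p| <= e / 2 * `|h|.
  apply: (@filter_forall _ _ (fun (i : 'I_N) (h : R) =>
    `|f i (h *: v + p) - f i p - h * 'D_v (f i) p| <= e / 2 * `|h|) (nbhs (0 : R))) => i.
  have [/derivableP/is_derive_epsP H _] := dfC i p.
  have [|d d0 Hd] := H (e / 2); first lra.
  apply/nbhs_ballP; exists d => // h; rewrite -ball_normE /= sub0r normrN.
  exact: Hd.
move=> /nbhs_ballP[d /= d0 Hd]; exists d => // h hd.
have {}Hd := Hd h ltac:(by rewrite -ball_normE /= sub0r normrN).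
rewrite -[h *: dyadic_sum _]/(h * _) -dyadic_sumZ // -!dyadic_sumB //; last 2 first.
- by exists (C + C) => k; apply: le_trans (ler_normB _ _) (lerD _ _).
- exact: bounded_seqZ.
have incr k : `|f k (h *: v + p) - f k p| <= `|h| * C.
  have := @directional_mean_value R V (f k) p v h 0 C; rewrite mulr0 subr0.
  by apply => s _; rewrite subr0; exact: dfC.
have := @dyadic_sum_le R (fun k => f k (h *: v + p) - f k p - h * 'D_v (f k) p)
  (`|h| * (C + C)) (e / 2 * `|h|) N.
move=> H; apply: le_trans (H _ _ _) _.
- by rewrite mulr_ge0 //; lra.
- move=> k; apply: le_trans (ler_normB _ _) _; rewrite mulrDr lerD // normrM.
  by rewrite ler_wpM2l //; have [] := dfC k p.
- by move=> k kN; exact: (Hd (Ordinal kN)).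
have -> : e * `|h| = e / 2 * `|h| + `|h| * (e / 2) by field.
rewrite lerD2l -mulrA ler_wpM2l //.
move: HN; rewrite ltr_pdivlMr; last lra.
have w0 : 0 <= (2^-1 : R) ^+ N by rewrite exprn_ge0.
lra.
Qed.

(** * Countable selection of barriers and the equivalence *)

Lemma exists_rat_near {R : realType} (x d : R) : 0 < d ->
  exists q : rat, `|x - ratr q| < d.
Proof.
move=> d0; have [q] := @rat_in_itvoo R (x - d) (x + d) ltac:(lra).
rewrite in_itv /= => /andP[? ?]; exists q.
by rewrite ltr_norml; apply/andP; split; lra.
Qed.

(* Lindelof: balls with rational centres and radii reduce the cover of
   [0, oo) x Xu by positivity sets of good barriers to a countable one. *)
Lemma countable_good_barriers {R : realType} {n : nat}
    {F : 'rV[R]_n -> 'rV[R]_n} {Xo Xu : set 'rV[R]_n} :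
  (forall t x, 0 <= t -> Xu x ->
     exists2 Psi, good_barrier F Xo Psi & 0 < Psi (t, x)) ->
  exists2 f : nat -> R * 'rV[R]_n -> R, forall k, good_barrier F Xo (f k) &
    forall t x, 0 <= t -> Xu x -> exists k, 0 < f k (t, x).
Proof.
move=> H.
pose ctr (key : rat * 'rV[rat]_n * rat) : R * 'rV[R]_n :=
  (ratr key.1.1, map_mx (ratr : rat -> R) key.1.2).
pose pos (key : rat * 'rV[rat]_n * rat) (Psi : R * 'rV[R]_n -> R) :=
  forall z, `|z - ctr key| < ratr key.2 -> 0 < Psi z.
have good0 : good_barrier F Xo (fun=> 0).
  have D0 v p : 'D_v (fun=> 0 : R) p = 0 :> R by exact: derive_cst.
  split => //.
  - by move=> p; rewrite lexx ler01.
  - exact: cst_continuous.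
  - move=> o; split.
      have -> : 'D_(coord_dir R n o) (fun=> 0 : R) = (fun=> 0) by apply/funext.
      exact: cst_continuous.
    by move=> p; split; [exact: derivable_cst|rewrite D0 normr0 ler01].
  - move=> p _; rewrite /lie_der D0 add0r big1 // => i _.
    by rewrite D0 mul0r.
(* Each natural number codes at most one rational ball; a barrier positive on all of it is chosen if
   one exists, and 0 otherwise. *)
have /choice[f Hf] : forall k : nat, exists Psi, good_barrier F Xo Psi /\
    forall key, unpickle k = Some key ->
      (exists2 Psi', good_barrier F Xo Psi' & pos key Psi') -> pos key Psi.
  move=> k; case: (unpickle k) => [key|]; last by exists (fun=> 0); split.
  have [[Psi gPsi pPsi]|nPsi] := pselect (exists2 Psi', good_barrier F Xo Psi' & pos key Psi').
    by exists Psi; split => // key' [<-].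
  by exists (fun=> 0); split => // key' [<-].
exists f => [k|t x t0 Xux]; first by have [] := Hf k.
have [Psi gPsi Psi0] := H t x t0 Xux.
have [_ cPsi _ _ _] := gPsi.
have /cvgrPdist_lt/(_ _ Psi0)/nbhs_ballP[r /= r0 Hr] := cPsi (t, x).
(* A ball of radius below [r / 2] that contains [(t, x)] lies in the ball of radius [r] around it,
   where [Psi] is positive. *)
have [rho] := @rat_in_itvoo R 0 (r / 2) ltac:(lra).
rewrite in_itv /= => /andP[rho0 rhor].
have rho20 : 0 < ratr rho / 2 :> R by lra.
have [q tq] := exists_rat_near t _ rho20.
have /choice[v Hv] := fun i : 'I_n => exists_rat_near (x 0 i) _ rho20.
pose key := (q, \row_i v i, rho).
have pk : `|(t, x) - ctr key| < ratr rho.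
  rewrite [ltLHS]/Num.norm /= gt_max; apply/andP; split; first lra.
  apply: le_lt_trans (_ : ratr rho / 2 < _); last lra.
  apply: norm_row_le => [|i]; first exact: ltW.
  by rewrite !mxE ltW.
exists (pickle key).
have [_ /(_ key (pickleK key)) Hpos] := Hf (pickle key).
apply: Hpos => //; exists Psi => // z zk.
have : `|Psi (t, x) - Psi z| < Psi (t, x).
  apply: Hr; rewrite -ball_normE /=.
  have := ler_distD (ctr key) (t, x) z; rewrite [`|ctr key - z|]distrC.
  by move: zk; rewrite /=; lra.
by have := ler_norm (Psi (t, x) - Psi z); lra.
Qed.

Theorem theorem4 (R : realType) (n : nat) (F : 'rV[R]_n -> 'rV[R]_n)
    (Xo Xu : set 'rV[R]_n) :
  C1_map F -> backward_complete F -> closed Xo -> Xo `&` Xu = set0 ->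
  (safe F Xo Xu <->
   exists B : R * 'rV[R]_n -> R,
     barrier_candidate Xo Xu B /\
     {within [set p : R * 'rV[R]_n | 0 <= p.1], continuous B} /\
     C1_on [set p | 0 <= p.1 /\ 0 < B p] B /\
     (forall p : R * 'rV[R]_n, 0 <= p.1 -> 0 < B p -> lie_der B F p <= 0)).
Proof.
move=> C1F bcF clXo _; split; last first.
  move=> [B [candB [cB [C1B lieB]]]].
  exact: barrier_safe (C1_map_continuous C1F) candB cB C1B lieB.
move=> safeF.
have [f gf fpos] := @countable_good_barriers R n F Xo Xu
  (fun t x t0 Xux => exists_good_barrier C1F bcF clXo safeF t0 Xux).
have f1 k p : `|f k p| <= 1.
  by have [/(_ p)/andP[? ?] _ _ _ _] := gf k; rewrite ger0_norm.
have f0 k p : 0 <= f k p by have [/(_ p)/andP[? ?] _ _ _ _] := gf k.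
have bf p : bounded_seq (fun k => f k p) by exists 1.
pose B p := dyadic_sum (fun k => f k p).
have df o k p : derivable (f k) p (coord_dir R n o) /\
    `|'D_(coord_dir R n o) (f k) p| <= 1.
  by have [_ _ /(_ o)[_ H] _ _] := gf k; exact: H.
have dB o p : is_derive p (coord_dir R n o) B
    (dyadic_sum (fun k => 'D_(coord_dir R n o) (f k) p)).
  by apply: (@is_derive_dyadic_sum _ _ f 1) => // k q; exact: df.
have bD o p : bounded_seq (fun k => 'D_(coord_dir R n o) (f k) p).
  by exists 1 => k; have [] := df o k p.
exists B; split; [split => t x t0 X|split; [|split]].
- have [k fk] := fpos t x t0 X.
  apply: lt_le_trans (dyadic_sum_ge_term k (bf (t, x)) _) => //.
  by rewrite mulr_gt0 // exprn_gt0.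
- have -> : B (t, x) = dyadic_sum (fun k => 0 * 0).
    congr dyadic_sum; apply/funext => k; rewrite mul0r.
    by have [_ _ _ H _] := gf k; exact: H.
  by rewrite dyadic_sumZ ?mul0r //; exists 0 => k; rewrite normr0.
- apply: continuous_subspaceT; apply: (@dyadic_sum_continuous _ _ f 1) => // k.
  by have [] := gf k.
(* The sum is C^1 on the whole space, negative times included, so no neighbourhood of the complement
   of [K] has to be built. *)
- exists setT; split => //; split; first exact: openT.
  move=> v dir p _.
  have [j vE] : exists j, v = coord_dir R n j.
    by case: dir => [->|[i ->]]; [exists None|exists (Some i)].
  rewrite vE; split; first by have [] := dB j p.
  have -> : 'D_(coord_dir R n j) B =
      (fun p => dyadic_sum (fun k => 'D_(coord_dir R n j) (f k) p)).
    by apply/funext => q; have [] := dB j q.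
  apply: (@dyadic_sum_continuous _ _ (fun k => 'D_(coord_dir R n j) (f k)) 1).
    by move=> k; have [_ _ /(_ j)[]] := gf k.
  by move=> k q; have [] := df j k q.
move=> p p0 _; pose c o := if o is Some i then F p.2 0 i else 1.
pose s := None :: [seq Some i | i <- enum 'I_n].
(* At a fixed [p] the Lie derivative is linear in the partial derivatives with coefficients [c], the
   form in which it commutes with [dyadic_sum]. *)
have lieE (g : R * 'rV[R]_n -> R) :
    lie_der g F p = \sum_(o <- s) c o * 'D_(coord_dir R n o) g p.
  rewrite big_cons big_map big_enum /= mul1r /lie_der; congr (_ + _).
  by apply: eq_bigr => i _; rewrite mulrC.
rewrite lieE.
have -> : \sum_(o <- s) c o * 'D_(coord_dir R n o) B p =
    \sum_(o <- s) c o * dyadic_sum (fun k => 'D_(coord_dir R n o) (f k) p).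
  by apply: eq_bigr => o _; have [_ ->] := dB o p.
have [bs <-] := dyadic_sum_sum s c (bD^~ p).
rewrite -oppr_ge0 -mulN1r -dyadic_sumZ //; apply: dyadic_sum_ge0.
  exact: bounded_seqZ.
move=> k; rewrite mulN1r oppr_ge0 -lieE.
by have [_ _ _ _ H] := gf k; exact: H.
Qed.
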